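(* Let $C$ be a symmetric absolutely continuous copula with square integrable density $c$, and let $K$ be the operator on $L^2(0,1)$ given by $Kf(x)=\int_0^1 c(x,y)f(y)\,dy$. Then $C$ can be represented as $$C(u,v)=uv+\sum_{k>1}\lambda_k\int_0^u\varphi_k(x)\,dx\int_0^v\varphi_k(y)\,dy,$$ where $\{1,\varphi_k : k>1,\ k\in\mathbb{N}\}$ is an orthonormal basis of $L^2(0,1)$ consisting of eigenfunctions of $K$ associated to the eigenvalues $\{1,\lambda_k : k>1,\ k\in\mathbb{N}\}$ of $K$ (i.e. $K1=1$ and $K\varphi_k=\lambda_k\varphi_k$).
   Context: A (bivariate) copula is the restriction to $[0,1]^2$ of a bivariate joint cumulative distribution function with uniform marginals on $(0,1)$. It is absolutely continuous with density $c\ge 0$ if $C(u,v)=\int_0^u\int_0^v c(s,t)\,dt\,ds$. It is symmetric if $C(u,v)=C(v,u)$ for all $(u,v)\in[0,1]^2$. The density is square integrable if $\int_0^1\int_0^1 c(s,t)^2\,dt\,ds<\infty$. The equality in the representation is understood as equality of operators on $L^2(0,1)$, i.e. the kernel expansion $c(u,v)=1+\sum_{k>1}\lambda_k\varphi_k(u)\varphi_k(v)$ holds in the $L^2$ sense. *)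

(* Defs.v *)
From HB Require Import structures.
From mathcomp Require Import all_boot all_order all_algebra.
From mathcomp Require Import all_classical all_reals all_analysis.
Set Implicit Arguments.
Unset Strict Implicit.
Unset Printing Implicit Defensive.
Import Order.TTheory GRing.Theory Num.Theory.
Import numFieldNormedType.Exports.

Local Open Scope classical_set_scope.
Local Open Scope ring_scope.

Notation leb R := (@lebesgue_measure R).
(* The measurable type underlying lebesgue_measure, convertible to R. *)
Notation borelR R := (measurableTypeR R).

Definition leb01 (R : realType) : {measure set (borelR R) -> \bar R} :=
  mrestr (leb R) (measurable_itv `]0%R, 1%R[).
Arguments leb01 : clear implicits.

(* Only the values of C on [0,1]^2 are meaningful; they are those of the joint
   cdf of a probability on the plane. *)
Definition copula (R : realType) (C : R -> R -> R) : Prop :=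
  exists P : probability (borelR R * borelR R)%type R,
    [/\ forall A : set (borelR R), measurable A ->
          P (A `*` setT) = uniform_prob (@ltr01 R) A,
        forall A : set (borelR R), measurable A ->
          P (setT `*` A) = uniform_prob (@ltr01 R) A &
        forall u v : R, u \in `[0, 1] -> v \in `[0, 1] ->
          (C u v)%:E = P (`]-oo, u] `*` `]-oo, v])].

Definition symmetric_copula (R : realType) (C : R -> R -> R) : Prop :=
  forall u v : R, u \in `[0, 1] -> v \in `[0, 1] -> C u v = C v u.

Definition copula_density (R : realType) (C : R -> R -> R) (c : R * R -> R)
    : Prop :=
  [/\ measurable_fun (`[0 : R, 1 : R] `*` `[0 : R, 1 : R])
        (c : borelR R * borelR R -> R),
      forall s t : R, s \in `[0, 1] -> t \in `[0, 1] -> 0 <= c (s, t) &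
      forall u v : R, u \in `[0, 1] -> v \in `[0, 1] ->
        (C u v)%:E =
        (\int[leb R]_(s in `[0%R, u]) \int[leb R]_(t in `[0%R, v])
           (c (s, t))%:E)%E].

Definition square_norm2 (R : realType) (g : R * R -> R) : \bar R :=
  (\int[leb R]_(s in `[0%R, 1%R]) \int[leb R]_(t in `[0%R, 1%R])
     ((g (s, t)) ^+ 2)%:E)%E.

Definition kernel_op (R : realType) (c : R * R -> R) (f : R -> R) : R -> R :=
  fun x => \int[leb R]_(y in `[0, 1]) (c (x, y) * f y).

(* Elements of L^2(0,1) are handled through representatives R -> R in
   Lfun (leb01 R) 2; equality in L^2(0,1) is equality leb01-almost everywhere. *)
Definition eigenfunction (R : realType) (c : R * R -> R) (a : R) (f : R -> R)
    : Prop :=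
  [/\ f \in Lfun (leb01 R) 2%:E,
      ~ (f = cst 0 %[ae leb01 R]) &
      kernel_op c f = (fun x => a * f x) %[ae leb01 R]].

Definition inner01 (R : realType) (f g : R -> R) : R :=
  \int[leb R]_(x in `[0, 1]) (f x * g x).

Definition orthonormal_basis (R : realType) (e : nat -> R -> R) : Prop :=
  [/\ forall n, e n \in Lfun (leb01 R) 2%:E,
      forall m n, inner01 (e m) (e n) = (m == n)%:R &
      forall f : R -> R, f \in Lfun (leb01 R) 2%:E ->
        'N[leb01 R]_2%:E [EFin \o (fun x =>
            f x - \sum_(0 <= k < n) inner01 f (e k) * e k x)%R]%E
          @[n --> \oo] --> 0%E].

(* The family {1, phi_k : k > 1}: index 0 is the constant function 1 and index
   n > 0 is phi_(n+1); phi_0 and phi_1 are not used. *)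
Definition with_one (R : realType) (phi : nat -> R -> R) : nat -> R -> R :=
  fun n => if n is 0%N then cst 1 else phi n.+1.

(* Main.v *)
(* The operator K is compact and self-adjoint on L^2(0,1): a bounded sequence has
   a weakly convergent subsequence f_n, along which K f_n converges pointwise and,
   being dominated by the norms of the rows of c, in L^2.  On the orthogonal
   complement of any set of eigenvectors K therefore has an eigenvector, unless
   this complement is 0, and a greedy choice starting from the constant 1 yields a
   complete orthonormal sequence e_j of eigenvectors.  For almost every x the
   coefficients of c(x, .) are K e_j(x) = lambda_j e_j(x), so that the expansion of
   c is that of its rows, integrated by dominated convergence, and the expansion of
   C follows from C(u, v) = <1_[0,u], K 1_[0,v]>. *)
Require Import Defs.
From HB Require Import structures.
From mathcomp Require Import all_boot all_order all_algebra.
From mathcomp Require Import all_classical all_reals all_analysis.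
From mathcomp Require Import measurable_realfun.
From mathcomp Require Import ring lra.
Import Order.TTheory GRing.Theory Num.Theory.
Import numFieldNormedType.Exports.
Set Implicit Arguments.
Unset Strict Implicit.
Unset Printing Implicit Defensive.
Import HBNNSimple.
Local Open Scope classical_set_scope.
Local Open Scope ring_scope.

(** * Semi-inner product spaces *)

(** Functions are not identified almost everywhere, so L^2 carries only a semi-inner product, and
    relations between vectors are read up to null vectors. The eigenvectors are not listed by
    decreasing modulus of the eigenvalue: infinitely many nonzero eigenvalues would then leave out
    the null space of K. Each one is chosen instead to correlate with a prescribed vector of a total
    sequence, which treats the eigenvalue 0 like any other. Symmetry is assumed of C and not of c,
    and uniformity of the marginals is a statement about the cdf; both are transferred to K by
    testing it on indicators of half lines, whose combinations are dense. Since c is controlled only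
    on the unit square, and its rows are square integrable only almost everywhere, K is studied
    through a modified kernel and the results are carried back to c. *)

Lemma sqr_cvg0 (R : realType) (u : nat -> R) :
  u n ^+ 2 @[n --> \oo] --> 0 -> u n @[n --> \oo] --> 0.
Proof.
move=> u2; apply/cvgr0Pnorm_lt => e e0.
have e20 : 0 < e ^+ 2 by rewrite exprn_gt0.
have /cvgr0Pnorm_lt/(_ _ e20) := u2.
apply: filterS => n; rewrite normrX => h.
by rewrite -(ltr_pXn2r (n := 2)) // nnegrE // ltW.
Qed.

(** Positivity without definiteness: the vectors will be functions, and [ip x x = 0] will mean that
    [x] vanishes almost everywhere. *)
Record semi_inner (R : realType) (V : lmodType R) (ip : V -> V -> R) : Prop :=
  SemiInner {
    ipC : forall x y, ip x y = ip y x;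
    ip_linear : forall a x y z, ip (a *: x + y) z = a * ip x z + ip y z;
    ip_ge0 : forall x, 0 <= ip x x }.

Section SemiInnerTheory.
Context (R : realType) (V : lmodType R) (ip : V -> V -> R).
Hypothesis hip : semi_inner ip.
Local Notation q x := (ip x x).

Lemma ipDl x y z : ip (x + y) z = ip x z + ip y z.
Proof. by rewrite -[x]scale1r (ip_linear hip) mul1r scale1r. Qed.

Lemma ip0l z : ip 0 z = 0.
Proof. by apply: (@addrI _ (ip 0 z)); rewrite -ipDl !addr0. Qed.

Lemma ipZl a x z : ip (a *: x) z = a * ip x z.
Proof. by rewrite -[a *: x]addr0 (ip_linear hip) ip0l addr0. Qed.

Lemma ipNl x z : ip (- x) z = - ip x z.
Proof. by rewrite -scaleN1r ipZl mulN1r. Qed.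

Lemma ipBl x y z : ip (x - y) z = ip x z - ip y z.
Proof. by rewrite ipDl ipNl. Qed.

Lemma ip_suml I (r : seq I) P (F : I -> V) z :
  ip (\sum_(i <- r | P i) F i) z = \sum_(i <- r | P i) ip (F i) z.
Proof. by apply: (big_morph (ip^~ z)); [move=> x y; exact: ipDl|exact: ip0l]. Qed.

Lemma ipDr x y z : ip x (y + z) = ip x y + ip x z.
Proof. by rewrite !(ipC hip x) ipDl. Qed.

Lemma ipZr a x z : ip x (a *: z) = a * ip x z.
Proof. by rewrite !(ipC hip x) ipZl. Qed.

Lemma ipNr x z : ip x (- z) = - ip x z.
Proof. by rewrite !(ipC hip x) ipNl. Qed.

Lemma ipBr x y z : ip x (y - z) = ip x y - ip x z.
Proof. by rewrite ipDr ipNr. Qed.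

Lemma ip_sumr I (r : seq I) P (F : I -> V) z :
  ip z (\sum_(i <- r | P i) F i) = \sum_(i <- r | P i) ip z (F i).
Proof. by rewrite (ipC hip) ip_suml; apply: eq_bigr => i _; exact: ipC. Qed.

Lemma ip_cauchy_schwarz x y : ip x y ^+ 2 <= q x * q y.
Proof.
have [qy0|qy0] := eqVneq (q y) 0.
  rewrite qy0 mulr0 leNgt; apply/negP => s0.
  (* When [q y = 0], [q (x - t y)] is [q x - 2 t ip x y]; this [t] makes it [- q x - 2], which is
     negative. *)
  have := ip_ge0 hip (x - ((q x + 1) / ip x y) *: y).
  rewrite ipBl !ipBr !ipZr !ipZl qy0 (ipC hip y x).
  rewrite !mulr0 divfK; first by have := ip_ge0 hip x; lra.
  by apply: contraTneq s0 => ->; rewrite expr0n ltxx.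
have {}qy0 : 0 < q y by rewrite lt0r qy0 (ip_ge0 hip).
rewrite -(ler_pM2l qy0) -subr_ge0.
have := ip_ge0 hip (q y *: x - ip x y *: y).
rewrite ipBl !ipBr !ipZr !ipZl (ipC hip y x).
by congr (0 <= _); ring.
Qed.

Lemma ip_null x y : q x = 0 -> ip x y = 0.
Proof.
move=> qx; have := ip_cauchy_schwarz x y; rewrite qx mul0r => h.
by apply/eqP; rewrite -sqrf_eq0 eq_le h sqr_ge0.
Qed.

Lemma q_add_le x y : q (x + y) <= 2 * q x + 2 * q y.
Proof.
have := ip_ge0 hip (x - y).
by rewrite ipBl ipDl !ipBr !ipDr; lra.
Qed.

Definition qcvg (u : nat -> V) (x : V) : Prop :=
  q (u n - x) @[n --> \oo] --> 0.

Lemma ip_cvg0 (u : nat -> V) y :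
  q (u n) @[n --> \oo] --> 0 -> ip (u n) y @[n --> \oo] --> 0.
Proof.
move=> u0; apply: sqr_cvg0.
apply: (@squeeze_cvgr _ _ _ _ (fun=> 0) (fun n => q (u n) * q y)).
- by apply: nearW => n; rewrite sqr_ge0 ip_cauchy_schwarz.
- exact: cvg_cst.
- by rewrite -(mul0r (q y)); apply: cvgM => //; exact: cvg_cst.
Qed.

Lemma qcvg_ip u x y : qcvg u x -> ip (u n) y @[n --> \oo] --> ip x y.
Proof.
move=> ux; have := @ip_cvg0 _ y ux.
under eq_fun do rewrite ipBl.
by move/subr_cvg0.
Qed.

Lemma qcvg_q u x : qcvg u x -> q (u n) @[n --> \oo] --> q x.
Proof.
move=> ux.
have -> : (fun n => q (u n)) = (fun n => q (u n - x) + 2 * ip (u n - x) x + q x).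
  by apply/funext => n; rewrite !(ipBl, ipBr) (ipC hip x (u n)); ring.
have h : q (u n - x) + 2 * ip (u n - x) x + q x @[n --> \oo] --> 0 + 2 * 0 + q x.
  apply: cvgD; last exact: cvg_cst.
  by apply: cvgD => //; apply: cvgM; [exact: cvg_cst|exact: ip_cvg0].
by rewrite mulr0 !add0r in h.
Qed.

Definition orthonormal (e : nat -> V) : Prop :=
  forall m n, ip (e m) (e n) = (m == n)%:R.

Definition orthonormal_upto (N : nat) (e : nat -> V) : Prop :=
  forall m n, (m < N)%N -> (n < N)%N -> ip (e m) (e n) = (m == n)%:R.

Lemma ip_orthonormal_sum (e : nat -> V) (c : nat -> R) n j :
  orthonormal_upto n e -> (j < n)%N -> ip (\sum_(k < n) c k *: e k) (e j) = c j.
Proof.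
move=> oe jn; rewrite ip_suml (bigD1 (Ordinal jn)) //= big1 ?addr0.
  by rewrite ipZl oe // eqxx mulr1.
move=> i ij; rewrite ipZl oe // (_ : (i == j :> nat) = false) ?mulr0 //.
by apply/negbTE; rewrite -(inj_eq val_inj) in ij.
Qed.

Lemma q_fourier_remainder (e : nat -> V) x n : orthonormal_upto n e ->
  q (x - \sum_(k < n) ip x (e k) *: e k) = q x - \sum_(k < n) ip x (e k) ^+ 2.
Proof.
move=> oe; rewrite ipBl !ipBr !ip_sumr !ip_suml.
have -> : \sum_(i < n) ip (ip x (e i) *: e i) x = \sum_(k < n) ip x (e k) ^+ 2.
  by apply: eq_bigr => i _; rewrite ipZl (ipC hip _ x) expr2.
have -> : \sum_(i < n) ip x (ip x (e i) *: e i) = \sum_(k < n) ip x (e k) ^+ 2.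
  by apply: eq_bigr => i _; rewrite ipZr expr2.
have -> : \sum_(i < n) ip (\sum_(k < n) ip x (e k) *: e k) (ip x (e i) *: e i) =
    \sum_(k < n) ip x (e k) ^+ 2.
  apply: eq_bigr => i _; rewrite ipZr (ip_orthonormal_sum (fun k => ip x (e k)) oe) // expr2.
by rewrite subrr subr0.
Qed.

Lemma bessel (e : nat -> V) x n : orthonormal_upto n e ->
  \sum_(k < n) ip x (e k) ^+ 2 <= q x.
Proof.
move=> oe; rewrite -subr_ge0 -q_fourier_remainder //; exact: ip_ge0.
Qed.

End SemiInnerTheory.

(** * Eigenbases of compact symmetric operators *)

Section SpectralTheorem.
Context (R : realType) (V : lmodType R) (ip : V -> V -> R) (T : V -> V).
Hypothesis hip : semi_inner ip.
Local Notation q x := (ip x x).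
Hypothesis T_linear : forall a x y, T (a *: x + y) = a *: T x + T y.
Hypothesis T_sym : forall x y, ip (T x) y = ip x (T y).
Hypothesis T_bounded : exists B, forall x, q (T x) <= B * q x.
(** Sequential compactness; [n <= s n] makes [s] tend to infinity, which is what passing to a limit
    along [s] uses. *)
Hypothesis T_compact : forall x : nat -> V, (forall n, q (x n) <= 1) ->
  exists (s : nat -> nat) (y : V),
    (forall n, (n <= s n)%N) /\ qcvg ip (T \o x \o s) y.

(** Equality up to a null vector; that [x] itself is not null is stated apart, as [q x = 1]. *)
Definition eigenvector a x := q (T x - a *: x) = 0.

Lemma eigenvector_ip a x y : eigenvector a x -> ip (T x) y = a * ip x y.
Proof.
move=> /(ip_null hip y)/eqP.
by rewrite (ipBl hip) (ipZl hip) subr_eq0 => /eqP.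
Qed.

Lemma TZ a x : T (a *: x) = a *: T x.
Proof.
have T0 : T 0 = 0.
  have := T_linear 1 0 0; rewrite !scale1r addr0 => h.
  by apply: (@addrI _ (T 0)); rewrite -h addr0.
by rewrite -[a *: x]addr0 T_linear T0 addr0.
Qed.

Lemma TD x y : T (x + y) = T x + T y.
Proof. by rewrite -[x]scale1r T_linear !scale1r. Qed.

Section OrthogonalComplement.
Variable S : V -> Prop.
Hypothesis S_eigen : forall e, S e -> exists a, eigenvector a e.
Let W x := forall e, S e -> ip x e = 0.

Let WD x y : W x -> W y -> W (x + y).
Proof. by move=> Wx Wy e Se; rewrite (ipDl hip) Wx // Wy // addr0. Qed.

Let WZ a x : W x -> W (a *: x).
Proof. by move=> Wx e Se; rewrite (ipZl hip) Wx // mulr0. Qed.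

Let WT x : W x -> W (T x).
Proof.
move=> Wx e Se; have [a ea] := S_eigen Se.
by rewrite T_sym (ipC hip) (eigenvector_ip _ ea) (ipC hip) Wx // mulr0.
Qed.

Let W_closed u x : (forall n, W (u n)) -> qcvg ip u x -> W x.
Proof.
move=> Wu ux e Se; have := qcvg_ip (y := e) hip ux.
under eq_fun do rewrite Wu //.
by move/(cvg_lim (@Rhausdorff R)) <-; rewrite lim_cst.
Qed.

Lemma q_normalize x : q x != 0 -> q ((Num.sqrt (q x))^-1 *: x) = 1.
Proof.
move=> qx; rewrite (ipZl hip) (ipZr hip) mulrA -invfM -expr2.
by rewrite sqr_sqrtr ?(ip_ge0 hip) // mulVf.
Qed.

(* Maximise q (T x) over the unit ball of S^perp: along a maximising sequence
   x n, T (T (x n)) - L x n tends to 0, so a limit y of T (x n) satisfies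
   T (T y) = L y, and T y + sqrt L y or y is an eigenvector of T. *)
Lemma eigenvector_exists x0 : W x0 -> q x0 != 0 ->
  exists2 y, W y /\ q y = 1 & exists a, eigenvector a y.
Proof.
move=> Wx0 qx0.
pose y0 := (Num.sqrt (q x0))^-1 *: x0.
have Wy0 : W y0 by exact: WZ.
have qy0 : q y0 = 1 by exact: q_normalize.
pose E := [set q (T x) | x in [set x | W x /\ q x = 1]].
have [B hB] := T_bounded.
have supE : has_sup E.
  split; first by exists (q (T y0)), y0.
  by exists B => _ [x [_ qx1] <-]; have := hB x; rewrite qx1 mulr1.
pose L := sup E.
have LE x : W x -> q x = 1 -> q (T x) <= L.
  by move=> Wx qx; apply: (ub_le_sup supE.2); exists x.
have Lq x : W x -> q (T x) <= L * q x.
  move=> Wx; have [qx|qx] := eqVneq (q x) 0.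
    by have := hB x; rewrite qx !mulr0.
  have := LE _ (WZ (Num.sqrt (q x))^-1 Wx) (q_normalize qx).
  rewrite TZ (ipZl hip) (ipZr hip) mulrA -invfM -expr2.
  rewrite sqr_sqrtr ?(ip_ge0 hip) // mulrC ler_pdivrMr //.
  by rewrite lt0r qx (ip_ge0 hip).
have L0 : 0 <= L by apply: le_trans (LE _ Wy0 qy0); exact: (ip_ge0 hip).
(* If [L = 0], [T] is null on the complement, and any unit vector there has eigenvalue 0. *)
have [L00|Lneq0] := eqVneq L 0.
  exists y0 => //; exists 0; rewrite /eigenvector scale0r subr0.
  apply/eqP; rewrite eq_le (ip_ge0 hip) andbT.
  by have := Lq y0 Wy0; rewrite L00 mul0r.
have /choice[x hx] : forall n, exists x, [/\ W x, q x = 1 & L - n.+1%:R^-1 < q (T x)].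
  move=> n; have n0 : 0 < n.+1%:R^-1 :> R by rewrite invr_gt0.
  have [_ [x [Wx qx] <-] h] := sup_adherent n0 supE.
  by exists x; split.
have qx1 n : q (x n) <= 1 by case: (hx n) => _ ->.
have [s [y [sn cy]]] := T_compact qx1.
have qTx : q (T (x n)) @[n --> \oo] --> L.
  apply: (@squeeze_cvgr _ _ _ _ (fun n => L - n.+1%:R^-1) (fun=> L)).
  - apply: nearW => n; case: (hx n) => Wx qx /ltW ->.
    exact: LE.
  - rewrite -[X in _ --> X]subr0; apply: cvgB; first exact: cvg_cst.
    exact: cvg_harmonic.
  - exact: cvg_cst.
have s_oo : s n @[n --> \oo] --> \oo.
  apply/cvgnyPge => A; exists A => // n /= An.
  exact: leq_trans An (sn n).
pose h n := T (x (s n)).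
have qh : q (h n) @[n --> \oo] --> L by exact: (cvg_comp _ _ s_oo qTx).
have Wh n : W (h n) by apply: WT; case: (hx (s n)).
(* After expansion, [q (T (h n)) <= L * q (h n)] and [ip (T (h n)) (x (s n)) = q (h n)] bound this
   by [L ^+ 2 - L * q (h n)], and [q (h n)] tends to [L]. *)
have d0 : q (T (h n) - L *: x (s n)) @[n --> \oo] --> 0.
  apply: (@squeeze_cvgr _ _ _ _ (fun=> 0) (fun n => L ^+ 2 - L * q (h n))).
  - apply: nearW => n; rewrite (ip_ge0 hip) /=.
    rewrite !(ipBl hip, ipBr hip) !(ipZl hip, ipZr hip).
    have [_ -> _] := hx (s n).
    have := Lq _ (Wh n).
    have e : ip (T (h n)) (x (s n)) = q (h n) by rewrite T_sym.
    by rewrite (ipC hip (x (s n)) (T (h n))) e; nra.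
  - exact: cvg_cst.
  - rewrite -(subrr (L ^+ 2)) {2}expr2; apply: cvgB; first exact: cvg_cst.
    by apply: cvgM => //; exact: cvg_cst.
have Wy : W y by exact: W_closed cy.
have qy : q y = L.
  by apply: cvg_unique (qcvg_q hip cy) _ => //; exact: qh.
have TTz z : ip (T (T y)) z = L * ip y z.
  apply/eqP; rewrite -subr_eq0; apply/eqP.
  have := ip_cvg0 hip (T z) d0.
  have hz : ip (T (h n) - L *: x (s n)) (T z) @[n --> \oo] --> ip y (T (T z)) - L * ip y z.
    have -> : (fun n => ip (T (h n) - L *: x (s n)) (T z)) =
        (fun n => ip (h n) (T (T z)) - L * ip (h n) z).
      apply/funext => n; rewrite (ipBl hip) (ipZl hip) T_sym.
      by rewrite -(T_sym (x (s n))).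
    apply: cvgB; first exact: qcvg_ip cy.
    by apply: cvgM; [exact: cvg_cst|exact: qcvg_ip cy].
  rewrite !T_sym => /(cvg_lim (@Rhausdorff R)) <-.
  by apply/esym/cvg_lim => //; exact: hz.
(* The relation factors as (T - m)(T + m) y = 0, whence the eigenvalue [- m] if (T + m) y is null,
   and [m] otherwise. *)
pose m := Num.sqrt L; have m2 : m * m = L by rewrite -expr2 sqr_sqrtr.
pose z := T y + m *: y.
have Wz : W z by apply: WD; [exact: WT|exact: WZ].
have ipe w (a : R) : (forall v, ip (T w) v = a * ip w v) -> eigenvector a w.
  by move=> wa; rewrite /eigenvector (ipBl hip) wa (ipZl hip) subrr.
have [qz|qz] := eqVneq (q z) 0.
  exists ((Num.sqrt (q y))^-1 *: y).
    by split; [exact: WZ|apply: q_normalize; rewrite qy].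
  exists (- m); apply: ipe => v; rewrite TZ !(ipZl hip) mulrCA; congr (_ * _).
  have := ip_null hip v qz.
  by rewrite (ipDl hip) (ipZl hip) => /eqP; rewrite addr_eq0 => /eqP ->; rewrite mulNr.
exists ((Num.sqrt (q z))^-1 *: z).
  by split; [exact: WZ|exact: q_normalize].
exists m; apply: ipe => v; rewrite TZ !(ipZl hip) mulrCA; congr (_ * _).
by rewrite TD TZ !(ipDl hip) !(ipZl hip) TTz -m2; ring.
Qed.

End OrthogonalComplement.

(** * Greedy choice of eigenvectors along a total sequence *)

Section Greedy.
Variable d : nat -> V.
Hypothesis d_total : forall x, (forall k, ip x (d k) = 0) -> q x = 0.
Hypothesis dim_infinite : forall N, exists h, orthonormal_upto ip N h.

Definition is_eigenvector x := exists a, eigenvector a x.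

Let good (s : seq V) := orthonormal_upto ip (size s) (nth 0 s) /\
  forall x, x \in s -> is_eigenvector x.
Let perp (s : seq V) x := forall y, y \in s -> ip x y = 0.

(** A double count. If the complement of the [N] vectors of [s] were null, each of [N.+1]
    orthonormal vectors [h i] would have its squared coefficients along [s] summing to 1, for a
    total of [N.+1]; but Bessel's inequality with respect to [h] allows each vector of [s] at most
    1, for a total of [N]. *)
Lemma perp_nontrivial s : orthonormal_upto ip (size s) (nth 0 s) ->
  exists2 x, perp s x & q x != 0.
Proof.
move=> os; apply: contrapT => nx.
have {}nx x : perp s x -> q x = 0.
  by move=> px; apply/eqP; apply: contrapT => /negP qx; apply: nx; exists x.
set N := size s in os; have [h oh] := dim_infinite N.+1.
have h1 (i : 'I_N.+1) : \sum_(k < N) ip (h i) (nth 0 s k) ^+ 2 = 1.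
  apply/esym/eqP; rewrite -subr_eq0.
  have <- : q (h i) = 1 by rewrite oh // eqxx.
  rewrite -(q_fourier_remainder hip _ os) nx // => y ys.
  have jN : (index y s < N)%N by rewrite index_mem.
  rewrite -(nth_index 0 ys) (ipBl hip).
  by rewrite (ip_orthonormal_sum hip (fun k => ip (h i) (nth 0 s k)) os jN) subrr.
have : \sum_(i < N.+1) \sum_(k < N) ip (h i) (nth 0 s k) ^+ 2 <= N%:R.
  rewrite exchange_big /=; apply: (@le_trans _ _ (\sum_(k < N) 1)).
    apply: ler_sum => k _.
    have <- : q (nth 0 s k) = 1 by rewrite os // eqxx.
    apply: le_trans (bessel hip _ oh).
    by apply: ler_sum => i _; rewrite (ipC hip).
  by rewrite sumr_const card_ord.
by rewrite (eq_bigr _ (fun i _ => h1 i)) sumr_const card_ord ler_nat ltnn.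
Qed.

(** The supremum of [ip f (d k) ^+ 2], finite by Cauchy-Schwarz, need not be attained, hence the
    factor 2: half of it is exceeded as soon as it is positive, and otherwise any admissible
    eigenvector will do. *)
Lemma greedy_step s k : good s -> exists e,
  [/\ q e = 1, is_eigenvector e, perp s e &
      forall f, q f = 1 -> is_eigenvector f -> perp s f ->
        ip f (d k) ^+ 2 <= 2 * ip e (d k) ^+ 2].
Proof.
move=> [os es]; have [x0 px0 qx0] := perp_nontrivial os.
have [e0 [pe0 qe0] ee0] := eigenvector_exists es px0 qx0.
pose C := [set f | [/\ q f = 1, is_eigenvector f & perp s f]].
pose E := [set ip f (d k) ^+ 2 | f in C].
have supE : has_sup E.
  split; first by exists (ip e0 (d k) ^+ 2), e0.
  exists (q (d k)) => _ [f [qf _ _] <-].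
  by apply: le_trans (ip_cauchy_schwarz hip _ _) _; rewrite qf mul1r.
have [E0|E0] := leP (sup E) 0.
  exists e0; split => // f qf ef pf.
  apply: (@le_trans _ _ 0); last by rewrite mulr_ge0 ?sqr_ge0.
  by apply: le_trans E0; apply: (ub_le_sup supE.2); exists f.
have E20 : 0 < sup E / 2 by rewrite divr_gt0.
have [_ [e [qe ee pe] <-] he] := sup_adherent E20 supE.
exists e; split => // f qf ef pf.
apply: (@le_trans _ _ (sup E)); first by apply: (ub_le_sup supE.2); exists f.
by move: he; lra.
Qed.

(** The first component of the pair coded by [n]: every [k] is the target of all the codes
    [pickle (k, j)]. Numbers that code no pair get 0. *)
Let target n : nat := (odflt (0, 0)%N (unpickle n)).1.

Lemma greedy_family u : q u = 1 -> is_eigenvector u -> exists e : nat -> V,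
  [/\ e 0%N = u, orthonormal ip e, forall n, is_eigenvector (e n) &
      forall n f, q f = 1 -> is_eigenvector f ->
        (forall i, ip f (e i) = 0) ->
        ip f (d (target n)) ^+ 2 <= 2 * ip (e n.+1) (d (target n)) ^+ 2].
Proof.
move=> qu eu.
have /choice[next nextP] : forall sk : seq V * nat, exists e, good sk.1 ->
  [/\ q e = 1, is_eigenvector e, perp sk.1 e &
      forall f, q f = 1 -> is_eigenvector f -> perp sk.1 f ->
        ip f (d sk.2) ^+ 2 <= 2 * ip e (d sk.2) ^+ 2].
  (* The value 0 on a list that is not [good] is arbitrary: the recursion below only meets good
     lists. *)
  move=> [s k]; have [gs|gs] := pselect (good s); last by exists 0.
  by have [e he] := greedy_step k gs; exists e.
(* The whole list is carried along, since the next vector must be orthogonal to all the previous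
   ones. [L n] has [n.+1] entries, so [target n] governs the choice of [e n.+1]. *)
pose fix L n := if n is n'.+1 then rcons (L n') (next (L n', target n'))
                else [:: u].
have sL n : size (L n) = n.+1 by elim: n => //= n IH; rewrite size_rcons IH.
have gL n : good (L n).
  elim: n => [|n IH].
    split; first by move=> [|//] [|//] _ _; rewrite eqxx.
    by move=> x; rewrite inE => /eqP ->.
  have [/= qe ee pe _] := nextP (L n, target n) IH.
  case: IH => oL eL; split; last first.
    by move=> x /=; rewrite mem_rcons inE => /predU1P[->|/eL].
  move=> i j; rewrite /= size_rcons !ltnS !nth_rcons => iN jN.
  have [ilt|ige] := ltnP i (size (L n)); have [jlt|jge] := ltnP j (size (L n)).
  - exact: oL.
  - have -> : j = size (L n) by apply/eqP; rewrite eqn_leq jN jge.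
    rewrite eqxx (ipC hip) pe ?mem_nth //.
    by rewrite (ltn_eqF ilt).
  - have -> : i = size (L n) by apply/eqP; rewrite eqn_leq iN ige.
    by rewrite eqxx pe ?mem_nth // eq_sym (ltn_eqF jlt).
  - have -> : i = size (L n) by apply/eqP; rewrite eqn_leq iN ige.
    have -> : j = size (L n) by apply/eqP; rewrite eqn_leq jN jge.
    by rewrite eqxx qe.
pose e n := nth 0 (L n) n.
have Le n i : (i <= n)%N -> nth 0 (L n) i = e i.
  elim: n => [|n IH]; first by rewrite leqn0 => /eqP ->.
  rewrite leq_eqVlt => /predU1P[->//|]; rewrite ltnS => i_n.
  by rewrite /= nth_rcons sL ltnS i_n IH.
have eS n : e n.+1 = next (L n, target n).
  by rewrite /e /= nth_rcons sL ltnn eqxx.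
exists e; split => //.
- move=> m n; rewrite -(Le (maxn m n) m) ?leq_maxl // -(Le (maxn m n) n) ?leq_maxr //.
  by apply: (gL (maxn m n)).1; rewrite sL ltnS ?leq_maxl ?leq_maxr.
- by move=> n; apply: (gL n).2; rewrite mem_nth // sL.
- move=> n f qf ef fe; rewrite eS.
  have [_ _ _] := nextP (L n, target n) (gL n); apply => //= y.
  move=> /(nthP 0)[i]; rewrite sL ltnS => i_n <-.
  by rewrite Le.
Qed.

Hypothesis complete : forall u : nat -> V,
  (forall eps : R, 0 < eps -> exists N, forall m n, (N <= m)%N -> (N <= n)%N ->
     q (u m - u n) <= eps) ->
  exists x, qcvg ip u x.

(* A sequence of orthonormal eigenvectors e n such that
   ip (e n) (d k) ^+ 2 is at least half the supremum over the unit eigenvectors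
   orthogonal to e 0, ..., e n.-1, each k being used for infinitely many n:
   by Bessel's inequality for d k an eigenvector orthogonal to all e n is
   orthogonal to all d k, hence null. *)
Theorem eigenbasis_exists u : q u = 1 -> is_eigenvector u ->
  exists e : nat -> V,
    [/\ e 0%N = u, orthonormal ip e, forall n, is_eigenvector (e n) &
        forall x, qcvg ip (fun n => \sum_(k < n) ip x (e k) *: e k) x].
Proof.
move=> qu eu; have [e [e0 oe ee he]] := greedy_family qu eu.
have ou n : orthonormal_upto ip n e by move=> i j _ _; exact: oe.
exists e; split => // x.
have no_eigen f : q f = 1 -> is_eigenvector f -> (forall i, ip f (e i) = 0) -> False.
  move=> qf ef fe; suff : q f = 0 by rewrite qf => /eqP; rewrite oner_eq0.
  apply: d_total => k; apply/eqP; rewrite -sqrf_eq0 eq_le sqr_ge0 andbT.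
  rewrite leNgt; apply/negP => fk0.
  pose e' (j : nat) := e (pickle (k, j)).+1.
  have oe' N : orthonormal_upto ip N e'.
    move=> i j _ _; rewrite /e' oe eqSS (inj_eq (pcan_inj pickleK)).
    by rewrite xpair_eqE eqxx.
  have bound N : N%:R * ip f (d k) ^+ 2 <= 2 * q (d k).
    apply: (@le_trans _ _ (\sum_(j < N) 2 * ip (d k) (e' j) ^+ 2)).
      rewrite mulr_natl -[N in X in X <= _]card_ord -sumr_const.
      apply: ler_sum => j _; rewrite (ipC hip (d k)).
      have := he (pickle (k, j : nat)) f qf ef fe.
      by rewrite /target pickleK.
    by rewrite -mulr_sumr ler_pM2l // bessel.
  pose N := (Num.truncn (2 * q (d k) / ip f (d k) ^+ 2)).+1.
  have := bound N; rewrite leNgt -ltr_pdivrMr // => /negP; apply.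
  exact: truncnS_gt.
pose c k := ip x (e k).
pose u' n := \sum_(k < n) c k *: e k.
pose S n := \sum_(k < n) c k ^+ 2.
have u'e n k : (k < n)%N -> ip (u' n) (e k) = c k.
  by move=> kn; exact: (ip_orthonormal_sum hip c (ou n) kn).
have qu' m n : (n <= m)%N -> q (u' m - u' n) = q (u' m) - S n.
  move=> nm; have -> : u' n = \sum_(k < n) ip (u' m) (e k) *: e k.
    by apply: eq_bigr => k _; rewrite u'e // (leq_trans _ nm).
  rewrite q_fourier_remainder //; congr (_ - _).
  by apply: eq_bigr => k _; rewrite u'e // (leq_trans _ nm).
have qu'S m : q (u' m) = S m.
  apply/eqP; rewrite -subr_eq0 -qu' // subrr.
  by rewrite (ip0l hip).
have S_nd : nondecreasing_seq S.
  apply/nondecreasing_seqP => n; rewrite /S big_ord_recr /=.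
  by rewrite lerDl sqr_ge0.
have S_cvg : cvgn S.
  apply: nondecreasing_is_cvgn => //; exists (q x) => _ [n _ <-].
  exact: (bessel hip _ (ou n)).
(* For [n <= m], [q (u' m - u' n)] is [S m - S n], and [S] converges because it is monotone and
   bounded by Bessel's inequality. *)
have [y uy] : exists y, qcvg ip u' y.
  apply: (@complete u') => eps eps0.
  have Sle n : S n <= limn S by exact: nondecreasing_cvgn_le.
  have /cvgrPdist_lt/(_ _ eps0)[N _ hN] := S_cvg.
  have main m n : (N <= m)%N -> (N <= n)%N -> (n <= m)%N -> q (u' m - u' n) <= eps.
    move=> Nm Nn nm; rewrite qu' // qu'S.
    have := hN n Nn; rewrite ltr_norml /= => /andP[_ h].
    by have := Sle m; move: h; lra.
  exists N => m n Nm Nn; have [nm|/ltnW mn] := leqP n m; first exact: main.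
  rewrite -[u' m - _]opprB (ipNl hip) (ipNr hip) opprK.
  exact: main.
(* The remainder [x - y] is orthogonal to every [e k]. Were it not null, the complement of the whole
   family would contain a unit eigenvector, which [no_eigen] excludes. *)
have yx : q (x - y) = 0.
  apply: contrapT => /eqP xy.
  have pxy f : (exists k, f = e k) -> ip (x - y) f = 0.
    move=> [k ->]; rewrite (ipBl hip) -/(c k).
    apply/eqP; rewrite subr_eq0; apply/eqP.
    have h := qcvg_ip (y := e k) hip uy.
    have h' : ip (u' n) (e k) @[n --> \oo] --> c k.
      apply: cvg_near_cst; exists k.+1 => // n /= kn.
      by rewrite u'e.
    by apply: (cvg_unique _ h' h).
  have [|f [pf qf] ef] := @eigenvector_exists (fun f => exists k, f = e k) _ _ pxy xy.
    by move=> f [k ->]; exact: ee.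
  by apply: (no_eigen f) => // i; apply: pf; exists i.
apply: (@squeeze_cvgr _ _ _ _ (fun=> 0) (fun n => 2 * q (u' n - y))).
- apply: nearW => n; rewrite (ip_ge0 hip) /=.
  have -> : \sum_(k < n) ip x (e k) *: e k - x = (u' n - y) + (y - x).
    by rewrite addrA subrK.
  apply: le_trans (q_add_le hip _ _) _.
  by rewrite -(opprB x y) (ipNl hip) (ipNr hip) opprK yx mulr0 addr0.
- exact: cvg_cst.
- rewrite -(mulr0 2); apply: cvgM => //; exact: cvg_cst.
Qed.

End Greedy.

End SpectralTheorem.

(** * The space L^2 of a finite measure *)

(* An ultrafilter finer than the Frechet filter selects a limit for all the
   sequences at once. *)
Lemma countable_bolzano_weierstrass (R : realType) (a : nat -> nat -> R)
    (M : nat -> R) : (forall k n, `|a k n| <= M k) ->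
  exists2 s : nat -> nat, (forall n, (n <= s n)%N) &
    forall k, cvgn (fun n => a k (s n)).
Proof.
move=> aM; have [F [FU sF]] := ultraFilterLemma eventually_filter.
have FF : ProperFilter F := @ultra_proper nat F FU.
have /choice[p hp] : forall k, exists p, forall e, 0 < e ->
    F [set n | `|p - a k n| < e].
  move=> k; have Fk : (a k @ F) `[- M k, M k]%classic.
    change (F (a k @^-1` `[- M k, M k])); apply: filterE => n /=.
    by rewrite in_itv /= -ler_norml.
  have [p [_ clp]] := @segment_compact R (- M k) (M k) (a k @ F) _ Fk.
  exists p => e e0.
  have [//|notin] := in_ultra_setVsetC [set n | `|p - a k n| < e] FU.
  have [_ [[n hn <-] pn]] := clp [set a k n | n in ~` [set n | `|p - a k n| < e]] _
    (filterS (fun n hn => imageP (a k) hn) notin) (nbhsx_ballx p e e0).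
  by exfalso; apply: hn.
(* Diagonal choice: finitely many members of the filter meet beyond [n], so that one index serves
   the first [n] sequences at once. *)
have /choice[s hs] : forall n, exists m, (n <= m)%N /\
    forall k : 'I_n, `|p k - a k m| < n.+1%:R^-1.
  move=> n; apply: (@filter_ex _ F); apply: filterI.
    by apply: sF; exists n.
  by apply: filter_forall => k; apply: hp; rewrite invr_gt0.
exists s => [n|k]; first by have [] := hs n.
apply/cvg_ex; exists (p k); apply/cvgrPdist_lt => e e0.
have /cvgr0Pnorm_lt/(_ _ e0)[N _ hN] := @cvg_harmonic R.
exists (maxn N k.+1) => // n /=; rewrite geq_max => /andP[Nn kn].
apply: lt_trans ((hs n).2 (Ordinal kn)) _.
by have := hN n Nn; rewrite /= ger0_norm // invr_ge0.
Qed.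

Section L2.
Context d (T : measurableType d) (R : realType).
Variable mu : {finite_measure set T -> \bar R}.

Definition L2 := LfunType mu (lee1n 2).

(** A total map, with value 0 outside L^2, so that [toL2 f] can be written before membership is
    known. *)
Definition toL2 (f : T -> R) : L2 := insubd (0 : L2) f.

Lemma toL2E f : f \in Lfun mu 2%:E -> toL2 f = f :> (T -> R).
Proof. exact: insubdK. Qed.

Lemma toL2K (f : L2) : toL2 f = f.
Proof. by apply/val_inj; rewrite /= toL2E // LfunP. Qed.

Lemma Lnorm2E (f : T -> R) :
  'N[mu]_2%:E[EFin \o f]%E = ((\int[mu]_x (f x ^+ 2)%:E) `^ 2^-1)%E.
Proof.
rewrite unlock /Lnorm; congr poweR; apply: eq_integral => x _ /=.
by rewrite powR_mulrn // real_normK ?num_real.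
Qed.

Lemma Lfun2P (f : T -> R) : f \in Lfun mu 2%:E <->
  measurable_fun setT f /\ (\int[mu]_x (f x ^+ 2)%:E < +oo)%E.
Proof.
split=> [Lf|[mf f2]].
  split; first by move: Lf; rewrite inE => /andP[/[!inE]].
  have /integrableP[_] := Lfun2_integrable_sqr Lf.
  by under eq_integral do rewrite gee0_abs ?lee_fin ?sqr_ge0 //.
rewrite inE; apply/andP; split; rewrite inE //=.
by rewrite /finite_norm Lnorm2E poweR_lty.
Qed.

Lemma Lfun2_le (f g : T -> R) : measurable_fun setT f -> g \in Lfun mu 2%:E ->
  (forall x, `|f x| <= `|g x|) -> f \in Lfun mu 2%:E.
Proof.
move=> mf /Lfun2P[mg g2] fg; apply/Lfun2P; split => //.
apply: le_lt_trans g2; apply: ge0_le_integral => //.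
- by move=> x _; rewrite lee_fin sqr_ge0.
- by apply/measurable_EFinP; exact: measurable_funX.
- by apply/measurable_EFinP; exact: measurable_funX.
- by move=> x _; rewrite lee_fin -[f x ^+ 2]real_normK ?num_real //
    -[g x ^+ 2]real_normK ?num_real // lerXn2r ?nnegrE.
Qed.

Lemma Lfun2_bounded (f : T -> R) M : measurable_fun setT f ->
  (forall x, `|f x| <= M) -> f \in Lfun mu 2%:E.
Proof.
move=> mf fM; apply: (@Lfun2_le _ (cst M)) => //; first exact: Lfun_cst.
by move=> x; apply: le_trans (fM x) (ler_norm _).
Qed.

Definition ip2 (f g : L2) : R := \int[mu]_x (f x * g x).

Lemma L2_measurable (f : L2) : measurable_fun setT f. Proof. by []. Qed.

Lemma integrable_mul (f g : L2) :
  mu.-integrable setT (EFin \o (fun x => f x * g x)).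
Proof. by apply/Lfun1_integrable; apply: Lfun2_mul_Lfun1; exact: LfunP. Qed.

Lemma semi_inner_ip2 : semi_inner ip2.
Proof.
split=> [f g|a f g h|f].
- by apply: eq_Rintegral => x _; rewrite mulrC.
- have ifh : mu.-integrable setT (EFin \o (fun x => a * (f x * h x))).
    have := integrable_mul (a *: f) h.
    by apply: eq_integrable => // x _ /=; rewrite mulrA.
  rewrite /ip2 -RintegralZl //; last exact: integrable_mul.
  rewrite -RintegralD //; last exact: integrable_mul.
  by apply: eq_Rintegral => x _ /=; rewrite mulrDl mulrA.
- by apply: Rintegral_ge0 => x _; rewrite -expr2 sqr_ge0.
Qed.

Lemma ip2_EFin (f g : L2) : (ip2 f g)%:E = (\int[mu]_x (f x * g x)%:E)%E.
Proof. by rewrite fineK //; exact: integrable_fin_num (integrable_mul f g). Qed.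

Lemma ip2_sqr (f : L2) : (ip2 f f)%:E = (\int[mu]_x (f x ^+ 2)%:E)%E.
Proof.
by rewrite ip2_EFin; apply: eq_integral => x _; rewrite expr2.
Qed.

Lemma ip2_null (f : L2) : ip2 f f = 0 -> f = cst 0 %[ae mu].
Proof.
move=> f0; have := ip2_sqr f; rewrite f0 => /esym f20.
have mf2 : measurable_fun setT (fun x => (f x ^+ 2)%:E).
  by apply/measurable_EFinP; exact: measurable_funX.
have : (\int[mu]_x `|(f x ^+ 2)%:E| = 0)%E.
  by under eq_integral do rewrite gee0_abs ?lee_fin ?sqr_ge0 //.
move/(ae_eq_integral_abs mu measurableT mf2).
apply: filterS => x /= h _; have [/eqP] := h I.
by rewrite sqrf_eq0 => /eqP.
Qed.

Lemma L2_sumE (I : Type) (r : seq I) (P : pred I) (F : I -> L2) x :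
  (\sum_(i <- r | P i) F i) x = \sum_(i <- r | P i) F i x.
Proof. by apply: (big_morph (fun f : L2 => f x)). Qed.

(** Dominated convergence for the squares: [(u n - f) ^+ 2] is at most [2 * g ^+ 2 + 2 * f ^+ 2]. *)
Lemma L2_dominated (u : nat -> L2) (f : L2) (g : T -> R) :
  g \in Lfun mu 2%:E ->
  {ae mu, forall x, u n x @[n --> \oo] --> f x} ->
  {ae mu, forall x, forall n, `|u n x| <= g x} ->
  qcvg ip2 u f.
Proof.
move=> Lg uf ug.
have mg : measurable_fun setT g by have /Lfun2P[] := Lg.
have ig : mu.-integrable setT (fun x => (2 * g x ^+ 2 + 2 * f x ^+ 2)%:E).
  have -> : (fun x => (2 * g x ^+ 2 + 2 * f x ^+ 2)%:E) =
    (fun x => 2%:E * (g x ^+ 2)%:E + 2%:E * (f x ^+ 2)%:E)%E.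
    by apply/funext => x; rewrite EFinD !EFinM.
  apply: integrableD => //; apply: integrableZl => //; apply: Lfun2_integrable_sqr => //.
  exact: LfunP.
have mu2 n : measurable_fun setT (fun x => ((u n x - f x) ^+ 2)%:E).
  apply/measurable_EFinP; apply: measurable_funX; exact: measurable_funB.
have uf0 : {ae mu, forall x, setT x -> ((u n x - f x) ^+ 2)%:E @[n --> \oo] --> cst 0%E x}.
  apply: filterS uf => x ufx _ /=; apply: cvg_EFin; first exact: nearW.
  have h : u n x - f x @[n --> \oo] --> f x - f x.
    by apply: cvgB => //; exact: cvg_cst.
  rewrite subrr in h; have := cvgM h h; rewrite mulr0; exact.
have ub : {ae mu, forall x n, setT x ->
    (`|((u n x - f x) ^+ 2)%:E| <= (2 * g x ^+ 2 + 2 * f x ^+ 2)%:E)%E}.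
  have uf' : {ae mu, forall x, `|f x| <= g x}.
    near=> x.
    have ufx : u n x @[n --> \oo] --> f x by near: x.
    have ugx : forall n, `|u n x| <= g x by near: x.
    by apply: (cvgr_to_le (cvg_norm ufx)); exact: nearW.
  near=> x; move=> n _.
  have ugx : forall n, `|u n x| <= g x by near: x.
  rewrite gee0_abs ?lee_fin ?sqr_ge0 //.
  apply: (@le_trans _ _ (2 * u n x ^+ 2 + 2 * f x ^+ 2)).
    by have := sqr_ge0 (u n x + f x); nra.
  rewrite lerD2r ler_pM2l // -[u n x ^+ 2]real_normK ?num_real //.
  by rewrite lerXn2r // nnegrE // (le_trans _ (ugx n)).
have [_ _] := dominated_convergence measurableT mu2 (measurable_cst _) uf0 ig ub.
rewrite integral_cst // mul0e => h.
have h' : (ip2 (u n - f) (u n - f))%:E @[n --> \oo] --> 0%:E.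
  by under eq_fun do rewrite ip2_sqr.
exact: fine_cvg h'.
Unshelve. all: by end_near. Qed.

(** The limit superior is measurable whether or not the sequence converges; [fine] removes its
    infinite values. *)
Lemma measurable_limit (h : nat -> T -> R) :
  (forall n, measurable_fun setT (h n)) ->
  exists2 f : T -> R, measurable_fun setT f &
    forall x, cvgn (h ^~ x) -> h n x @[n --> \oo] --> f x.
Proof.
move=> mh; exists (fun x => fine (limn_esup (fun n => (h n x)%:E))).
  apply: (measurableT_comp (fine_measurable measurableT)).
  by apply: measurable_fun_limn_esup => n; apply/measurable_EFinP.
move=> x /cvg_ex[l hl].
have hE : (h n x)%:E @[n --> \oo] --> l%:E by apply: cvg_EFin => //; exact: nearW.
by have [_ ->] := cvg_limn_einf_sup hE.
Qed.

(** Fatou's lemma for the squares. Membership of the limit in L^2 is a conclusion here, and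
    completeness rests on it. *)
Lemma L2_fatou (u : nat -> L2) (f : T -> R) M : measurable_fun setT f ->
  {ae mu, forall x, u n x @[n --> \oo] --> f x} ->
  (forall n, ip2 (u n) (u n) <= M) ->
  f \in Lfun mu 2%:E /\ ip2 (toL2 f) (toL2 f) <= M.
Proof.
move=> mf uf uM.
have mu2 n : measurable_fun setT (fun x => (u n x ^+ 2)%:E).
  by apply/measurable_EFinP; exact: measurable_funX.
have fM : (\int[mu]_x (f x ^+ 2)%:E <= M%:E)%E.
  apply: (@le_trans _ _ (\int[mu]_x limn_einf (fun n => (u n x ^+ 2)%:E))%E).
    apply: ae_ge0_le_integral => //.
    - by move=> x _; rewrite lee_fin sqr_ge0.
    - by apply/measurable_EFinP; exact: measurable_funX.
    - move=> x _; rewrite limn_einf_lim; apply: lime_ge.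
        exact: is_cvg_einfs.
      by apply: nearW => n; apply: le_ereal_inf_tmp => _ [m _ <-]; rewrite lee_fin sqr_ge0.
    - have -> : (fun x => limn_einf (fun n => (u n x ^+ 2)%:E)) =
          (fun x => - limn_esup (fun n => - (u n x ^+ 2)%:E))%E.
        by apply/funext => x; rewrite -limn_einfN; congr limn_einf; apply/funext => n; rewrite /comp oppeK.
      apply: measurableT_comp => //; apply: measurable_fun_limn_esup => n.
      exact: measurableT_comp.
    - apply: filterS uf => x ufx _.
      have h : (u n x ^+ 2)%:E @[n --> \oo] --> (f x ^+ 2)%:E.
        apply: cvg_EFin; first exact: nearW.
        have := cvgM ufx ufx; exact.
      by have [-> _] := cvg_limn_einf_sup h.
  have u20 n x : setT x -> (0 <= (u n x ^+ 2)%:E)%E by rewrite lee_fin sqr_ge0.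
  apply: le_trans (fatou mu measurableT mu2 u20) _.
  rewrite limn_einf_lim; apply: lime_le; first exact: is_cvg_einfs.
  apply: nearW => n; apply: (@le_trans _ _ (\int[mu]_x (u n x ^+ 2)%:E)%E).
    by apply: ereal_inf_lbound; exists n => /=.
  by rewrite -ip2_sqr lee_fin.
have Lf : f \in Lfun mu 2%:E.
  by apply/Lfun2P; split => //; apply: le_lt_trans fM _; rewrite ltry.
split=> //; rewrite -lee_fin ip2_sqr.
by under eq_integral do rewrite toL2E //.
Qed.

(** The integrals are dominated by a geometric series of sum [C], so the sum of the [g k] is
    integrable, hence finite almost everywhere. *)
Lemma ae_series_cvg (g : nat -> T -> R) (C : R) :
  (forall k, measurable_fun setT (g k)) -> (forall k x, 0 <= g k x) ->
  (forall k, \int[mu]_x (g k x)%:E <= (C / (2 ^ (k + 1))%:R)%:E)%E ->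
  {ae mu, forall x, cvgn (series (g ^~ x))}.
Proof.
move=> mg g0 gC.
have mE k : measurable_fun setT (EFin \o g k) by exact/measurable_EFinP.
have iG : mu.-integrable setT (fun x => \sum_(0 <= k <oo) (g k x)%:E)%E.
  apply/integrableP; split.
    apply: ge0_emeasurable_sum => [k x _ _|k _]; first by rewrite lee_fin.
    exact: mE.
  under eq_integral.
    move=> x _; rewrite gee0_abs; last by apply: nneseries_ge0 => k _ _; rewrite lee_fin.
    over.
  rewrite integral_nneseries //; last by move=> k x _; rewrite lee_fin.
  apply: (@le_lt_trans _ _ (\sum_(0 <= k <oo) (C / (2 ^ (k + 1))%:R)%:E)%E).
    apply: lee_nneseries => // k _ _; apply: integral_ge0 => x _; by rewrite lee_fin.
  have /cvg_lim -> // := @cvg_geometric_eseries_half R C 0.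
  by rewrite ltry.
apply: filterS (integrable_ae measurableT iG) => x /(_ I) xfin.
apply: nondecreasing_is_cvgn.
  by apply/nondecreasing_seqP => n; rewrite seriesSr lerDl.
exists (fine (\sum_(0 <= k <oo) (g k x)%:E)%E) => _ [n _ <-].
rewrite -lee_fin fineK // /series /= -sumEFin.
by apply: nneseries_lim_ge => k _ _; rewrite lee_fin.
Qed.

(** Riesz-Fischer: a fast subsequence converges almost everywhere, and Fatou's lemma shows that its
    limit is the limit of [u] in L^2. *)
Lemma L2_complete (u : nat -> L2) :
  (forall eps : R, 0 < eps -> exists N, forall m n, (N <= m)%N -> (N <= n)%N ->
     ip2 (u m - u n) (u m - u n) <= eps) ->
  exists f, qcvg ip2 u f.
Proof.
move=> cu.
have /choice[N hN] : forall k, exists N, forall m n, (N <= m)%N -> (N <= n)%N ->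
    ip2 (u m - u n) (u m - u n) <= (4 ^+ k)^-1.
  by move=> k; apply: cu; rewrite invr_gt0 exprn_gt0.
pose s k := (k + \max_(i < k.+1) N i)%N.
have Ns k m : (k <= m)%N -> (N k <= s m)%N.
  move=> km; apply: leq_trans (leq_addl _ _).
  by rewrite -ltnS in km; exact: (leq_bigmax (F := fun i : 'I_m.+1 => N i) (Ordinal km)).
have ks k : (k <= s k)%N by exact: leq_addr.
pose v k := u (s k).
pose g (k : nat) (x : T) : R := `|v k.+1 x - v k x|.
have mg k : measurable_fun setT (g k).
  by apply: measurableT_comp => //; exact: measurable_funB.
have gC k : (\int[mu]_x (g k x)%:E <= ((2 * (1 + fine (mu setT))) / (2 ^ (k + 1))%:R)%:E)%E.
  have k0 : 0 < 2 ^+ k :> R by rewrite exprn_gt0.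
  (* The pointwise bound [|t| <= 2 ^+ k * t ^+ 2 + (2 ^+ k)^-1] replaces Hölder's inequality; a
     squared norm at most [(4 ^+ k)^-1] then gives [(2 ^+ k)^-1 * (1 + mu T)]. *)
  apply: (@le_trans _ _ (\int[mu]_x ((2 ^+ k)%:E * (((v k.+1 - v k) x) ^+ 2)%:E + (2 ^+ k)^-1%:E))%E).
    apply: ge0_le_integral => //.
    - by move=> x _; rewrite lee_fin /g.
    - by apply/measurable_EFinP; exact: mg.
    - apply: emeasurable_funD => //; apply: measurable_funeM.
      by apply/measurable_EFinP; apply: measurable_funX.
    - move=> x _; rewrite lee_fin /g -[v k.+1 x - v k x]/((v k.+1 - v k) x).
      set t := (v k.+1 - v k) x.
      rewrite -[t ^+ 2]real_normK ?num_real //.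
      rewrite -subr_ge0 -(pmulr_rge0 _ k0) mulrBr mulrDr mulfV ?gt_eqF //.
      have := sqr_ge0 (2 ^+ k * `|t| - 1); have := normr_ge0 t.
      by nra.
  have mf2 : measurable_fun setT (fun x => ((v k.+1 - v k) x ^+ 2)%:E).
    by apply/measurable_EFinP; exact: measurable_funX.
  rewrite ge0_integralD //; last 2 first.
  - by move=> x _; rewrite -EFinM lee_fin mulr_ge0 ?sqr_ge0 // ltW.
  - exact: measurable_funeM.
  have f20 x : setT x -> (0 <= ((v k.+1 - v k) x ^+ 2)%:E)%E by rewrite lee_fin sqr_ge0.
  rewrite (ge0_integralZl_EFin mu measurableT f20 mf2 (ltW k0)).
  rewrite integral_cst // -ip2_sqr.
  have := hN k (s k.+1) (s k) (Ns _ _ (leqnSn k)) (Ns _ _ (leqnn k)).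
  rewrite -/(v k.+1) -/(v k); move: (ip2 _ _) => I h.
  rewrite -[X in (_ + _ * X)%E]fineK ?fin_num_measure // -!EFinM -EFinD lee_fin.
  have -> : 2 * (1 + fine (mu setT)) / (2 ^ (k + 1))%:R =
      (2 ^+ k)^-1 + (2 ^+ k)^-1 * fine (mu setT).
    by rewrite natrX addn1 exprS invfM; field; rewrite gt_eqF.
  rewrite lerD2r mulrC -ler_pdivlMr //; apply: le_trans h _.
  by rewrite -invfM -expr2 -exprM mulnC exprM; have -> : 2 ^+ 2 = 4 :> R by rewrite -natrX.
have vcvg : {ae mu, forall x, cvgn (fun k => v k x)}.
  apply: filterS (ae_series_cvg mg (fun k x => normr_ge0 _) gC) => x gx.
  have : cvgn [series v k.+1 x - v k x]_k by exact: normed_cvg.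
  move=> /cvg_ex[l hl]; apply/cvg_ex; exists (v 0%N x + l).
  have -> : (fun k => v k x) = (fun k => v 0%N x + [series v k.+1 x - v k x]_k k).
    apply/funext => k; rewrite /series /= telescope_sumr //.
    by rewrite addrC subrK.
  by apply: cvgD => //; exact: cvg_cst.
have [f mf hf] := measurable_limit (fun k => L2_measurable (v k)).
(* To be used twice: with [w = u K], to see that [f] is in L^2, and with [w = u n], to bound the
   distance from [u n] to [f]. *)
have fatou_sub K (w : L2) M : (forall k, (K <= k)%N -> ip2 (v k - w) (v k - w) <= M) ->
    (fun x => f x - w x) \in Lfun mu 2%:E /\
    ip2 (toL2 (fun x => f x - w x)) (toL2 (fun x => f x - w x)) <= M.
  move=> hM; apply: (@L2_fatou (fun k => v (k + K)%N - w)).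
  - exact: measurable_funB.
  - apply: filterS vcvg => x /hf vx.
    apply: cvgB; last exact: cvg_cst.
    by rewrite -(cvg_shiftn K) in vx.
  - by move=> k; apply: hM; exact: leq_addl.
have Lf : f \in Lfun mu 2%:E.
  have [K hK] := cu 1 ltr01.
  have [Lfw _] := fatou_sub K (u K) 1 (fun k Kk => hK _ _ (leq_trans Kk (ks k)) (leqnn K)).
  have -> : f = (toL2 (fun x => f x - u K x) + u K : L2) :> (T -> R).
    by apply/funext => x /=; rewrite toL2E // subrK.
  exact: LfunP.
exists (toL2 f); apply/cvgr0Pnorm_le => e e0; have [K hK] := cu e e0.
exists K => // n /= Kn; rewrite ger0_norm ?(ip_ge0 semi_inner_ip2) //.
have [_] := fatou_sub K (u n) e (fun k Kk => hK _ _ (leq_trans Kk (ks k)) Kn).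
have -> : toL2 (fun x => f x - u n x) = toL2 f - u n.
  rewrite -[RHS]toL2K; congr toL2; apply/funext => x /=.
  by rewrite toL2E.
rewrite -(opprB (u n) (toL2 f)).
by rewrite (ipNl semi_inner_ip2) (ipNr semi_inner_ip2) opprK.
Qed.

(** * Density arguments in L^2 as an induction over closed subspaces *)

Lemma indic_L2 (A : set T) : measurable A -> (\1_A : T -> R) \in Lfun mu 2%:E.
Proof.
move=> mA; apply: (@Lfun2_bounded _ 1); first exact: measurable_indic.
by move=> x; rewrite indicE; case: (x \in A); rewrite ?normr1 ?normr0.
Qed.

Definition closed_subspace (P : L2 -> Prop) : Prop :=
  (forall a f g, P f -> P g -> P (a *: f + g)) /\
  (forall u f, (forall n, P (u n)) -> qcvg ip2 u f -> P f).

Section Induction.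
Variable P : L2 -> Prop.
Hypothesis cP : closed_subspace P.

Lemma closed_subspace_sum (I : eqType) (r : seq I) (F : I -> L2) f : P f ->
  (forall i, i \in r -> P (F i)) -> P (\sum_(i <- r) F i).
Proof.
(* [closed_subspace] also holds of the empty predicate; a member [f] gives [0 = - f + f], needed for
   the empty sum. *)
move=> Pf; have P0 : P 0 by rewrite -(addNr f) -scaleN1r; exact: cP.1.
elim: r => [|i r IH] PF; first by rewrite big_nil.
rewrite big_cons -[F i]scale1r; apply: cP.1; first by apply: PF; rewrite inE eqxx.
by apply: IH => j jr; apply: PF; rewrite inE jr orbT.
Qed.

(** Dynkin's theorem: complements come from linearity and the constant 1, disjoint unions from L^2
    limits of partial sums dominated by 1. *)
Lemma closed_subspace_indic (G : set (set T)) : @measurable _ T = <<s G >> ->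
  setI_closed G -> P (toL2 (cst 1)) -> (forall A, G A -> P (toL2 \1_A)) ->
  forall A, measurable A -> P (toL2 \1_A).
Proof.
move=> mG GI P1 PG A mA.
have P0 : P 0 by rewrite -(addNr (toL2 (cst 1))) -scaleN1r; exact: cP.1.
apply: (@dynkin_induction _ T G (fun A => P (toL2 \1_A))) => //; last by rewrite -mG.
- by rewrite indicT.
- move=> S mS PS.
  have -> : toL2 \1_(~` S) = - toL2 \1_S + toL2 (cst 1).
    rewrite -[RHS]toL2K; congr toL2; apply/funext => x /=.
    rewrite (toL2E (indic_L2 mS)) toL2E ?Lfun_cst //.
    rewrite -[RHS]/(- \1_S x + 1) !indicE in_setC.
    by case: (x \in S); rewrite /= ?subrr ?oppr0 ?addNr ?add0r.
  by rewrite -scaleN1r; exact: cP.1.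
- move=> F mF tF PF.
  pose u n : L2 := \sum_(k <- index_iota 0 n) toL2 \1_(F k).
  have mU : measurable (\bigcup_k F k) by exact: bigcup_measurable.
  have uE n x : u n x = \sum_(0 <= k < n) \1_(F k) x.
    by rewrite L2_sumE; apply: eq_bigr => k _; rewrite toL2E ?indic_L2.
  have uj n x j : F j x -> u n x = (j < n)%:R.
    move=> Fjx; rewrite uE.
    have Fk k : \1_(F k) x = (k == j)%:R :> R.
      rewrite indicE; congr (_ %:R); have [->|kj] := eqVneq k j.
        by rewrite mem_set.
      by rewrite memNset // => Fkx; move/eqP: kj; apply; apply: (tF k j) => //; exists x.
    under eq_bigr do rewrite Fk.
    rewrite big_mkord; have [jn|nj] := ltnP j n.
      rewrite (bigD1 (Ordinal jn)) //= eqxx big1 ?addr0 // => i /eqP ij.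
      by case: eqP => // e; exfalso; apply: ij; exact/val_inj.
    rewrite big1 // => i _; case: eqP => // e.
    by move: (ltn_ord i); rewrite e ltnNge nj.
  have u0 n x : ~ (\bigcup_k F k) x -> u n x = 0.
    move=> nF; rewrite uE big1 // => k _; rewrite indicE memNset // => Fk.
    by apply: nF; exists k.
  apply: (cP.2 u).
    by move=> n; apply: (closed_subspace_sum P0).
  apply: (@L2_dominated _ _ (cst 1)); first exact: Lfun_cst.
    apply: aeW => x; rewrite toL2E ?indic_L2 // indicE.
    have [[j _ Fjx]|nF] := pselect ((\bigcup_k F k) x).
      rewrite mem_set; last by exists j.
      by apply: cvg_near_cst; exists j.+1 => // n /= jn; rewrite (uj _ _ _ Fjx) jn.
    by rewrite memNset //; apply: cvg_near_cst; apply: nearW => n; rewrite u0.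
  apply: aeW => x n /=.
  have [[j _ Fjx]|nF] := pselect ((\bigcup_k F k) x); last by rewrite u0 // normr0.
  by rewrite (uj _ _ _ Fjx); case: (j < n)%N; rewrite ?normr1 ?normr0.
Qed.

Lemma closed_subspace_ge0 : (forall A, measurable A -> P (toL2 \1_A)) ->
  forall f : L2, (forall x, 0 <= f x) -> P f.
Proof.
move=> PA f f0.
have mf : measurable_fun setT (EFin \o f) by exact/measurable_EFinP.
pose h := nnsfun_approx measurableT mf.
have f0' x : setT x -> (0 <= (EFin \o f) x)%E by rewrite lee_fin f0.
have hf x : h n x @[n --> \oo] --> f x.
  exact: fine_cvg (cvg_nnsfun_approx measurableT mf f0' (x := x) I).
have hle n x : h n x <= f x.
  rewrite -(cvg_lim (@Rhausdorff R) (hf x)).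
  apply: (nondecreasing_cvgn_le (u_ := fun n => h n x)); last exact: cvgP (hf x).
  by move=> a b ab; exact: (lefP _ _ (nd_nnsfun_approx measurableT mf ab)).
have Lh n : (h n : T -> R) \in Lfun mu 2%:E.
  apply: Lfun2_le (LfunP f) _ => // x.
  by rewrite !ger0_norm.
apply: (cP.2 (fun n => toL2 (h n))); last first.
  apply: (@L2_dominated _ _ f); first exact: LfunP.
    apply: aeW => x; have -> : (fun n => toL2 (h n) x) = (fun n => h n x).
      by apply/funext => n; rewrite toL2E.
    exact: hf.
  by apply: aeW => x n; rewrite toL2E // ger0_norm ?hle.
move=> n; pose r := finmap.enum_fset (fset_set (range (h n))).
have -> : toL2 (h n) = \sum_(y <- r) y *: toL2 \1_(h n @^-1` [set y]).
  rewrite -[RHS]toL2K; congr toL2; apply/funext => x.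
  rewrite L2_sumE fimfunE fsbig_finite //=.
  by apply: eq_bigr => y _; rewrite toL2E // indic_L2.
have P1 := PA _ measurableT.
apply: (closed_subspace_sum P1) => y _.
rewrite -[X in P X]addr0; apply: cP.1; first exact: PA.
by rewrite -(addNr (toL2 \1_setT)) -scaleN1r; exact: cP.1.
Qed.

Lemma L2_induction (G : set (set T)) : @measurable _ T = <<s G >> ->
  setI_closed G -> P (toL2 (cst 1)) -> (forall A, G A -> P (toL2 \1_A)) ->
  forall f, P f.
Proof.
move=> mG GI P1 PG f; have PA := closed_subspace_indic mG GI P1 PG.
have Lp : f^\+ \in Lfun mu 2%:E.
  apply: Lfun2_le (LfunP f) _ => [|x]; first exact: measurable_funrpos.
  by rewrite ger0_norm ?funrpos_ge0 // /funrpos ge_max ler_norm normr_ge0.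
have Ln : f^\- \in Lfun mu 2%:E.
  apply: Lfun2_le (LfunP f) _ => [|x]; first exact: measurable_funrneg.
  by rewrite ger0_norm ?funrneg_ge0 // /funrneg ge_max -normrN ler_norm normr_ge0.
have -> : f = - toL2 f^\- + toL2 f^\+.
  rewrite -[LHS]toL2K -[RHS]toL2K; congr toL2; rewrite -[LHS]funrposBneg.
  by apply/funext => x /=; rewrite !toL2E // addrC.
by rewrite -scaleN1r; apply: cP.1; apply: (closed_subspace_ge0 PA) => x; rewrite toL2E ?funrpos_ge0 ?funrneg_ge0.
Qed.

End Induction.
End L2.

(** * Square integrable kernels *)

Section Kernel.
Context d (T : measurableType d) (R : realType).
Variable mu : {finite_measure set T -> \bar R}.
Local Notation L2 := (L2 mu).
Local Notation ip2 := (@ip2 d T R mu).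
Local Notation toL2 := (toL2 mu).
Let hip : semi_inner ip2 := semi_inner_ip2 mu.
Variable k : T * T -> R.
Hypothesis k_measurable : measurable_fun setT k.
Hypothesis k_row : forall x, (fun y => k (x, y)) \in Lfun mu 2%:E.
Hypothesis k_fin : (\int[mu]_x \int[mu]_y (k (x, y) ^+ 2)%:E < +oo)%E.

Definition kernel_row x : L2 := toL2 (fun y => k (x, y)).
Let N x := ip2 (kernel_row x) (kernel_row x).

Lemma kernel_rowE x y : kernel_row x y = k (x, y).
Proof. by rewrite /kernel_row toL2E. Qed.

Lemma kernel_norm_sqr x : (N x)%:E = (\int[mu]_y (k (x, y) ^+ 2)%:E)%E.
Proof. by rewrite ip2_sqr; under eq_integral do rewrite kernel_rowE. Qed.

Lemma measurable_kernel_sqr : measurable_fun setT (fun z => (k z ^+ 2)%:E).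
Proof. by apply/measurable_EFinP; exact: measurable_funX. Qed.

Lemma kernel_norm_integrable : mu.-integrable setT (EFin \o N).
Proof.
have -> : EFin \o N = fubini_F mu (fun z => (k z ^+ 2)%:E).
  by apply/funext => x; rewrite /= kernel_norm_sqr.
apply/integrableP; split.
  apply: measurable_fun_fubini_tonelli_F; first exact: measurable_kernel_sqr.
  by move=> z; rewrite lee_fin sqr_ge0.
rewrite (eq_integral (fun x => \int[mu]_y (k (x, y) ^+ 2)%:E)%E) // => x _.
by rewrite gee0_abs // integral_ge0 // => y _; rewrite lee_fin sqr_ge0.
Qed.

Lemma measurable_kernel_norm : measurable_fun setT N.
Proof. by apply/measurable_EFinP; exact: measurable_int kernel_norm_integrable. Qed.

Definition kernel_fun (f : L2) (x : T) : R := ip2 (kernel_row x) f.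

(** Measurability comes from Fubini's theorem: [k (x, y) * f y] is integrable on the product, being
    at most [k (x, y) ^+ 2 + f y ^+ 2] in absolute value, where the second term is integrable
    because [mu] is finite. *)
Lemma measurable_kernel_fun f : measurable_fun setT (kernel_fun f).
Proof.
have mkf : measurable_fun setT (fun z : T * T => (k z * f z.2)%:E).
  apply/measurable_EFinP; apply: measurable_funM => //.
  exact: measurableT_comp.
have ikf : (mu \x mu)%E.-integrable setT (fun z : T * T => (k z * f z.2)%:E).
  apply/integrable12ltyP; first exact: mkf.
  apply: (@le_lt_trans _ _ (\int[mu]_x ((N x)%:E + (ip2 f f)%:E))%E); last first.
    rewrite integralD //=; first last.
    - exact: finite_measure_integrable_cst.
    - exact: kernel_norm_integrable.
    - by apply: lte_add_pinfty; apply: integrable_lty => //;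
        [exact: kernel_norm_integrable|exact: finite_measure_integrable_cst].
  apply: ge0_le_integral => //.
  - by move=> x _; exact: integral_ge0.
  - apply: (measurable_fun_fubini_tonelli_F (m2 := mu) (fun z => `|(k z * f z.2)%:E|%E)) => //.
    exact: measurableT_comp.
  - by apply: emeasurable_funD => //; apply/measurable_EFinP; exact: measurable_kernel_norm.
  - move=> x _; rewrite kernel_norm_sqr ip2_sqr -ge0_integralD //.
    + apply: ge0_le_integral => //.
      * by apply: measurableT_comp => //; exact: measurableT_comp mkf _.
      * by apply: emeasurable_funD; apply/measurable_EFinP; apply: measurable_funX => //;
          exact: measurableT_comp k_measurable _.
      * move=> y _; rewrite /= lee_fin normrM -[k _ ^+ 2]real_normK ?num_real //.
        rewrite -[f y ^+ 2]real_normK ?num_real //.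
        have := normr_ge0 (k (x, y)); have := normr_ge0 (f y).
        by nra.
    + by move=> y _; rewrite lee_fin sqr_ge0.
    + by apply/measurable_EFinP; apply: measurable_funX; exact: measurableT_comp k_measurable _.
    + by move=> y _; rewrite lee_fin sqr_ge0.
    + by apply/measurable_EFinP; exact: measurable_funX.
have := measurable_fubini_F ikf.
move/(measurableT_comp (fine_measurable measurableT)).
congr (measurable_fun _ _); apply/funext => x /=.
by congr fine; apply: eq_integral => y _; rewrite kernel_rowE.
Qed.

Lemma kernel_fun_sqr f x : kernel_fun f x ^+ 2 <= N x * ip2 f f.
Proof. exact: ip_cauchy_schwarz. Qed.

(** By Cauchy-Schwarz on each row, this function dominates the image of any [f] with
    [ip2 f f <= c]. *)
Lemma sqrt_kernel_norm_L2 (c : R) : 0 <= c ->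
  (fun x => Num.sqrt (N x * c)) \in Lfun mu 2%:E.
Proof.
move=> c0; apply/Lfun2P; split.
  apply: (measurableT_comp (continuous_measurable_fun (@sqrt_continuous R))).
  by apply: measurable_funM => //; exact: measurable_kernel_norm.
under eq_integral do rewrite sqr_sqrtr ?mulr_ge0 ?(ip_ge0 hip) // EFinM.
apply: integrable_lty => //; rewrite /=; apply: integrableZr => //.
exact: kernel_norm_integrable.
Qed.

Lemma kernel_fun_L2 f : kernel_fun f \in Lfun mu 2%:E.
Proof.
apply: Lfun2_le (sqrt_kernel_norm_L2 (ip_ge0 hip f)) _; first exact: measurable_kernel_fun.
move=> x; rewrite [leRHS]ger0_norm ?sqrtr_ge0 // -sqrtr_sqr ler_wsqrtr //.
exact: kernel_fun_sqr.
Qed.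

Definition kernel_map (f : L2) : L2 := toL2 (kernel_fun f).

Lemma kernel_mapE f x : kernel_map f x = kernel_fun f x.
Proof. by rewrite /kernel_map toL2E ?kernel_fun_L2. Qed.

Lemma kernel_map_linear a f g :
  kernel_map (a *: f + g) = a *: kernel_map f + kernel_map g.
Proof.
rewrite -[RHS]toL2K; congr toL2; apply/funext => x.
rewrite /kernel_fun (ipDr hip) (ipZr hip).
by rewrite -[RHS]/(a * kernel_map f x + kernel_map g x) !kernel_mapE.
Qed.

Lemma kernel_map_bounded : exists B, forall f,
  ip2 (kernel_map f) (kernel_map f) <= B * ip2 f f.
Proof.
exists (\int[mu]_x N x) => f; rewrite -RintegralZr //; last exact: kernel_norm_integrable.
apply: le_Rintegral => //.
- exact: integrable_mul.
- apply: (integrableZr measurableT (ip2 f f) kernel_norm_integrable).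
- by move=> x _; rewrite !kernel_mapE -expr2; exact: kernel_fun_sqr.
Qed.

(** * Compactness of the operator and expansion of its kernel *)

Section Compact.
Variable dn : nat -> L2.
Hypothesis dn_dense : forall P, closed_subspace P -> (forall n, P (dn n)) ->
  forall f, P f.

(** Diagonal extraction settles the vectors [dn m]; the [f] for which the scalar products converge
    form a closed subspace because [u] is bounded. No weak limit is constructed: the operator only
    sees the scalar products with the rows of [k]. *)
Lemma weakly_convergent_subsequence (u : nat -> L2) :
  (forall n, ip2 (u n) (u n) <= 1) ->
  exists2 s : nat -> nat, (forall n, (n <= s n)%N) &
    forall f, cvgn (fun n => ip2 f (u (s n))).
Proof.
move=> u1.
have ipu f n : `|ip2 f (u n)| <= Num.sqrt (ip2 f f).
  rewrite -sqrtr_sqr ler_wsqrtr //; apply: le_trans (ip_cauchy_schwarz hip _ _) _.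
  by rewrite ler_piMr ?u1 // (ip_ge0 hip).
have [s ns cs] := countable_bolzano_weierstrass (fun m n => ipu (dn m) n).
exists s; first exact: ns.
apply: dn_dense; last by move=> m; exact: cs.
split.
  move=> a f g cf cg.
  under eq_fun do rewrite (ipDl hip) (ipZl hip).
  apply: is_cvgD; last exact: cg.
  by apply: is_cvgM; [exact: is_cvg_cst|exact: cf].
move=> v f cv vf; apply: cauchy_cvg; apply: cauchy_exP => e e0.
have e20 : 0 < e / 2 by rewrite divr_gt0.
have /cvgr0Pnorm_lt/(_ _ (exprn_gt0 2 e20))[m _ /(_ m (leqnn m)) /= hm] := vf.
have close n : `|ip2 f (u (s n)) - ip2 (v m) (u (s n))| < e / 2.
  rewrite -(ipBl hip) -(ltr_pXn2r (n := 2)) // ?nnegrE // ?ltW //.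
  rewrite real_normK ?num_real //; apply: le_lt_trans (ip_cauchy_schwarz hip _ _) _.
  rewrite -(opprB (v m) f) (ipNl hip) (ipNr hip) opprK.
  apply: le_lt_trans _ (le_lt_trans (ler_norm _) hm).
  by rewrite ler_piMr ?u1 // (ip_ge0 hip).
exists (limn (fun n => ip2 (v m) (u (s n)))).
have /cvgrPdist_lt/(_ _ e20) := cv m.
apply: filterS => n hn; rewrite /ball /= [e]splitr.
apply: le_lt_trans (ler_distD (ip2 (v m) (u (s n))) _ _) _.
by rewrite ltrD // distrC.
Qed.


Lemma kernel_map_compact (u : nat -> L2) : (forall n, ip2 (u n) (u n) <= 1) ->
  exists (s : nat -> nat) (f : L2),
    (forall n, (n <= s n)%N) /\ qcvg ip2 (kernel_map \o u \o s) f.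
Proof.
move=> u1; have [s ns cs] := weakly_convergent_subsequence u1.
have [g mg hg] := measurable_limit (fun n => measurable_kernel_fun (u (s n))).
have gN x : kernel_fun (u (s n)) x @[n --> \oo] --> g x by apply: hg; exact: cs.
have L1 := sqrt_kernel_norm_L2 (@ler01 R).
have bound n x : `|kernel_fun (u (s n)) x| <= Num.sqrt (N x * 1).
  rewrite -sqrtr_sqr ler_wsqrtr //; apply: le_trans (kernel_fun_sqr _ _) _.
  by rewrite ler_wpM2l // (ip_ge0 hip).
have Lg : g \in Lfun mu 2%:E.
  apply: Lfun2_le L1 _ => // x; rewrite (ger0_norm (sqrtr_ge0 _)).
  by apply: (cvgr_to_le (cvg_norm (gN x))); exact: nearW.
exists s, (toL2 g); split => //; apply: (L2_dominated L1).
  apply: aeW => x; rewrite toL2E // /comp.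
  by under eq_fun do rewrite kernel_mapE; exact: gN.
by apply: aeW => x n; rewrite /comp kernel_mapE; exact: bound.
Qed.
Hypothesis kernel_map_sym : forall f g, ip2 (kernel_map f) g = ip2 f (kernel_map g).
Hypothesis dim_infinite : forall n, exists h, orthonormal_upto ip2 n h.

(** The vectors orthogonal to [f] form a closed subspace; once it contains the [dn n] it contains
    [f] itself. *)
Lemma dn_total f : (forall n, ip2 f (dn n) = 0) -> ip2 f f = 0.
Proof.
move=> fd; apply: (dn_dense (P := fun g => ip2 f g = 0)) => //; split.
  by move=> a g h fg fh; rewrite (ipDr hip) (ipZr hip) fg fh mulr0 addr0.
move=> u g fu ug; have := qcvg_ip (y := f) hip ug.
under eq_fun do rewrite (ipC hip) fu.
by rewrite (ipC hip) => /(cvg_lim (@Rhausdorff R)) <-; rewrite lim_cst.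
Qed.

Theorem kernel_spectral (f0 : L2) : ip2 f0 f0 = 1 ->
  eigenvector ip2 kernel_map 1 f0 ->
  exists (e : nat -> L2) (lambda : nat -> R),
    [/\ e 0%N = f0, orthonormal ip2 e,
        forall n, eigenvector ip2 kernel_map (lambda n) (e n),
        forall f, qcvg ip2 (fun n => \sum_(j < n) ip2 f (e j) *: e j) f &
        (\int[mu]_x \int[mu]_y
          ((k (x, y) - \sum_(j < n) lambda j * e j x * e j y) ^+ 2)%:E)%E
          @[n --> \oo] --> 0%E].
Proof.
move=> q0 e0.
have ef0 : is_eigenvector ip2 kernel_map f0 by exists 1.
have [e [e00 oe ee ecvg]] := eigenbasis_exists hip kernel_map_linear kernel_map_sym
  kernel_map_bounded kernel_map_compact dn_total dim_infinite (@L2_complete _ _ _ mu) q0 ef0.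
have /choice[lam hlam] := ee.
exists e, lam; split => //.
pose F n x := (\int[mu]_y ((k (x, y) - \sum_(j < n) lam j * e j x * e j y) ^+ 2)%:E)%E.
pose E n x := ip2 (kernel_row x - \sum_(j < n) ip2 (kernel_row x) (e j) *: e j)
  (kernel_row x - \sum_(j < n) ip2 (kernel_row x) (e j) *: e j).
have ou n : orthonormal_upto ip2 n e by move=> i j _ _; exact: oe.
(* The Fourier remainder of a row is at most its squared norm, which is the integrable majorant. *)
have EN n x : E n x <= N x.
  by rewrite /E q_fourier_remainder // lerBlDr lerDl sumr_ge0 // => j _; exact: sqr_ge0.
have E0 x : E n x @[n --> \oo] --> 0.
  have -> : E ^~ x = (fun n =>
      ip2 (\sum_(j < n) ip2 (kernel_row x) (e j) *: e j - kernel_row x)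
          (\sum_(j < n) ip2 (kernel_row x) (e j) *: e j - kernel_row x)).
    by apply/funext => n; rewrite /E -(opprB _ (kernel_row x)) (ipNl hip) (ipNr hip) opprK.
  exact: ecvg.
(* Each eigenvalue relation fails on a null set depending on [j]; countably many are merged, so that
   one [x] serves the whole expansion. *)
have eig : {ae mu, forall x, forall j, kernel_fun (e j) x = lam j * e j x}.
  apply: ae_foralln => j; have := ip2_null (hlam j).
  apply: filterS => x /(_ I) h; apply/eqP; rewrite -subr_eq0 -kernel_mapE.
  exact/eqP.
have FE : {ae mu, forall x, forall n, F n x = (E n x)%:E}.
  apply: filterS eig => x ex n; rewrite /F /E ip2_sqr; apply: eq_integral => y _.
  congr (_ ^+ 2)%:E.
  rewrite -[RHS]/(kernel_row x y - (\sum_(j < n) ip2 (kernel_row x) (e j) *: e j) y).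
  rewrite kernel_rowE L2_sumE; congr (_ - _); apply: eq_bigr => j _.
  by rewrite -[RHS]/(kernel_fun (e j) x * e j y) ex.
have mF n : measurable_fun setT (F n).
  apply: (measurable_fun_fubini_tonelli_F (m2 := mu)
    (fun z => ((k z - \sum_(j < n) lam j * e j z.1 * e j z.2) ^+ 2)%:E)).
    apply/measurable_EFinP; apply: measurable_funX; apply: measurable_funB => //.
    apply: measurable_sum => j; apply: measurable_funM; last exact: measurableT_comp.
    by apply: measurable_funM => //; exact: measurableT_comp.
  by move=> z; rewrite lee_fin sqr_ge0.
have F0 : {ae mu, forall x, setT x -> F n x @[n --> \oo] --> cst 0%E x}.
  apply: filterS FE => x Fx _; under eq_fun do rewrite Fx.
  by apply: cvg_EFin; [exact: nearW|exact: E0].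
have FN : {ae mu, forall x n, setT x -> (`|F n x| <= (EFin \o N) x)%E}.
  apply: filterS FE => x Fx n _; rewrite Fx /= lee_fin ger0_norm; first exact: EN.
  exact: (ip_ge0 hip).
have [_ _] := dominated_convergence measurableT mF (measurable_cst _) F0
  kernel_norm_integrable FN.
by rewrite integral_cst // mul0e.
Qed.

End Compact.

(** Both sides are linear and continuous in each variable, so the identity extends from [D] one
    variable at a time. *)
Lemma kernel_map_sym_on (D : set L2) :
  (forall P, closed_subspace P -> (forall f, D f -> P f) -> forall f, P f) ->
  (forall f g, D f -> D g -> ip2 (kernel_map f) g = ip2 f (kernel_map g)) ->
  forall f g, ip2 (kernel_map f) g = ip2 f (kernel_map g).
Proof.
move=> D_dense DD.
have cont u f : qcvg ip2 u f -> qcvg ip2 (kernel_map \o u) (kernel_map f).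
  move=> uf; have [B hB] := kernel_map_bounded.
  apply: (@squeeze_cvgr _ _ _ _ (fun=> 0) (fun n => B * ip2 (u n - f) (u n - f))).
  - apply: nearW => n; rewrite (ip_ge0 hip) /=.
    have -> : kernel_map (u n) - kernel_map f = kernel_map (u n - f).
      by rewrite (addrC (u n)) -[in RHS]scaleN1r kernel_map_linear scaleN1r addrC.
    exact: hB.
  - exact: cvg_cst.
  - by rewrite -(mulr0 B); apply: cvgM => //; exact: cvg_cst.
have lim_eq (a b : nat -> R) (x y : R) : (forall n, a n = b n) ->
    a n @[n --> \oo] --> x -> b n @[n --> \oo] --> y -> x = y.
  move=> /funext ab ax bx; rewrite -(cvg_lim (@Rhausdorff R) ax).
  by rewrite -(cvg_lim (@Rhausdorff R) bx) -ab.
have Dl g : D g -> forall f, ip2 (kernel_map f) g = ip2 f (kernel_map g).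
  move=> Dg; apply: D_dense => [|f Df]; last exact: DD.
  split=> [a f1 f2 h1 h2|u f hu uf].
    by rewrite kernel_map_linear !(ipDl hip) !(ipZl hip) h1 h2.
  apply: (lim_eq _ _ _ _ hu); last exact: qcvg_ip uf.
  exact: (qcvg_ip hip (cont _ _ uf)).
move=> f; apply: D_dense => [|g Dg]; last exact: Dl.
split=> [a f1 f2 h1 h2|u g hu ug].
  by rewrite kernel_map_linear !(ipDr hip) !(ipZr hip) h1 h2.
rewrite (ipC hip) (ipC hip f); apply: (lim_eq _ _ _ _ (fun n => hu n)).
  by under eq_fun do rewrite (ipC hip); exact: qcvg_ip ug.
by under eq_fun do rewrite (ipC hip); exact: (qcvg_ip hip (cont _ _ ug)).
Qed.

End Kernel.

(** * L^2 on the unit interval *)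

Section UnitInterval.
Variable R : realType.

Lemma leb01_fin : fin_num_fun (leb01 R).
Proof.
move=> A mA; rewrite ge0_fin_numE ?measure_ge0 //.
apply: (@le_lt_trans _ _ (leb R `]0, 1[)).
  by apply: le_measure => //; rewrite ?inE //; exact: measurableI.
by rewrite lebesgue_measure_itv /= lte_fin ltr01 -EFinB ltry.
Qed.

(** The function and the measure structure are those of [leb01], so facts over [mu01] answer goals
    over [leb01]. *)
Definition mu01 : {finite_measure set (borelR R) -> \bar R} :=
  HB.pack_for {finite_measure set (borelR R) -> \bar R}
    (leb01 R : set _ -> \bar R) (Measure.class (leb01 R))
    (Measure_isFinite.Build _ _ _ (leb01 R) leb01_fin).

Lemma ae01 (P : borelR R -> Prop) :
  (forall x : R, 0 < x < 1 -> P x) -> {ae mu01, forall x, P x}.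
Proof.
move=> hP; exists (~` `]0, 1[%classic); split.
- exact: measurableC.
- by rewrite /mu01 /= /mrestr setICl measure0.
- by move=> x /= nP; rewrite in_itv /= => h; apply: nP; exact: hP.
Qed.

(** Passage from the integrals over [0, 1] of the statement to [mu01]. The end points are null, and
    [f] is constrained only inside the interval, like functions built from [c]. *)
Lemma integral01 (f g : R -> \bar R) :
  measurable_fun (`]0, 1[%classic : set (borelR R)) f ->
  measurable_fun (setT : set (borelR R)) g -> (forall x, 0 < x < 1 -> f x = g x) ->
  (\int[leb R]_(x in `[0%R, 1%R]) f x = \int[mu01]_x g x)%E.
Proof.
move=> mf mg fg; rewrite integral_itv_bndoo //.
transitivity (\int[leb R]_(x in `]0%R, 1%R[) g x)%E.
  by apply: eq_integral => x; rewrite inE /= in_itv /=; exact: fg.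
rewrite (@eq_measure_integral _ _ _ _ mu01); last first.
  move=> A mA A01; rewrite /mu01 /= /mrestr; congr (_ _).
  by apply/esym/setIidPl.
rewrite integral_mkcond; apply: ae_eq_integral => //.
  by apply/(measurable_restrictT _ _).1 => //; exact: measurable_funS mg.
by apply: ae01 => x x01 _; rewrite /patch mem_set.
Qed.

Lemma Rintegral01 (f g : R -> R) :
  measurable_fun (`]0, 1[%classic : set (borelR R)) f ->
  measurable_fun (setT : set (borelR R)) g -> (forall x, 0 < x < 1 -> f x = g x) ->
  \int[leb R]_(x in `[0, 1]) f x = \int[mu01]_x g x.
Proof.
move=> mf mg fg; congr fine; apply: integral01.
- exact/measurable_EFinP.
- exact/measurable_EFinP.
- by move=> x x01; rewrite fg.
Qed.

Lemma inner01E (f g : L2 mu01) : inner01 f g = ip2 f g.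
Proof.
have m : measurable_fun (setT : set (borelR R)) (fun x => f x * g x).
  exact: measurable_funM.
by apply: Rintegral01 => //; exact: measurable_funS m.
Qed.

(** With respect to [mu01] this is the indicator of [0, u] when [0 <= u <= 1]. *)
Definition ray (u : R) : L2 mu01 := toL2 mu01 \1_(`]-oo, u]%classic : set (borelR R)).

Lemma rayE (u x : R) : ray u x = (x <= u)%R%:R.
Proof.
rewrite /ray toL2E; last exact: indic_L2.
by rewrite indicE; congr (GRing.natmul 1 (nat_of_bool _)); apply/idP/idP => [|h]; rewrite ?inE /= in_itv.
Qed.

(** The constant sequence [f] converges to [g] as well: limits are determined only up to null
    sets. *)
Lemma closed_subspace_ae (P : L2 mu01 -> Prop) (f g : L2 mu01) : closed_subspace P ->
  {ae mu01, forall x, f x = g x} -> P f -> P g.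
Proof.
move=> cP fg Pf; apply: (cP.2 (fun=> f)) => //.
apply: (@L2_dominated _ _ _ _ _ _ (fun x => `|f x|)).
- apply: Lfun2_le (LfunP f) _; first exact: measurableT_comp.
  by move=> x; rewrite normr_id.
- by apply: filterS fg => x <-; exact: cvg_cst.
- by apply: aeW => x _; exact: lexx.
Qed.

(** Open half lines, complements of rays, form a generating pi-system. The parameter is restricted
    to [0, 1], where the copula is known; other rays agree almost everywhere with [ray 0] or with
    1. *)
Lemma rays_dense (P : L2 mu01 -> Prop) : closed_subspace P ->
  (forall u, 0 <= u <= 1 -> P (ray u)) -> forall f, P f.
Proof.
move=> cP Pray.
have P1 : P (toL2 mu01 (cst 1)).
  have h01 : (0 : R) <= (1 : R) <= (1 : R) by lra.
  apply: closed_subspace_ae cP _ (Pray 1 h01); apply: ae01 => x /andP[_ x1].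
  by rewrite rayE toL2E ?Lfun_cst // ltW.
have Pr u : P (ray u).
  have [u0|u0] := ltP u 0.
    have h00 : (0 : R) <= (0 : R) <= (1 : R) by lra.
    apply: closed_subspace_ae cP _ (Pray 0 h00); apply: ae01 => x /andP[x0 _].
    by rewrite !rayE !leNgt x0 (lt_trans u0 x0).
  have [u1|u1] := leP u 1; first by apply: Pray; rewrite u0 u1.
  apply: closed_subspace_ae cP _ P1; apply: ae01 => x /andP[_ x1].
  by rewrite rayE toL2E ?Lfun_cst // (ltW (lt_trans x1 u1)).
apply: (@L2_induction _ _ _ _ _ cP (@RGenOInfty.G R)) => //.
- exact: RGenOInfty.measurableE.
- move=> _ _ [x ->] [y ->]; exists (Num.max x y).
  by apply/seteqP; split=> z /=; rewrite !in_itv /= !andbT gt_max;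
    [move=> [-> ->]|move=> /andP[]].
- move=> _ [x ->].
  have -> : toL2 mu01 \1_(`]x, +oo[%classic) = - ray x + toL2 mu01 (cst 1).
    rewrite -[RHS]toL2K; apply: (congr1 (toL2 mu01)); apply/funext => y.
    rewrite -[RHS]/(- ray x y + toL2 mu01 (cst 1) y) rayE toL2E ?Lfun_cst //.
    rewrite indicE; have [yx|xy] := leP y x.
      by rewrite memNset ?addNr // /= in_itv /= andbT ltNge yx.
    by rewrite mem_set ?oppr0 ?add0r // /= in_itv /= andbT.
  by rewrite -scaleN1r; apply: cP.1.
Qed.

Definition rational_ray (n : nat) : L2 mu01 := ray (ratr (odflt 0%Q (unpickle n))).

Lemma rational_rays_dense (P : L2 mu01 -> Prop) : closed_subspace P ->
  (forall n, P (rational_ray n)) -> forall f, P f.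
Proof.
move=> cP Pq; apply: (rays_dense cP) => u _.
(* Approach from the right: rays contain their end point, so [x <= r n] eventually agrees with
   [x <= u], even at [x = u]. *)
have /choice[r hr] : forall n, exists r : rat, u < ratr r < u + n.+1%:R^-1.
  move=> n; have [|r] := @rat_in_itvoo R u (u + n.+1%:R^-1).
    by rewrite ltrDl invr_gt0.
  by rewrite in_itv /=; exists r.
apply: (cP.2 (fun n => ray (ratr (r n)))) => [n|].
  by have := Pq (pickle (r n)); rewrite /rational_ray pickleK.
apply: (@L2_dominated _ _ _ _ _ _ (cst 1)); first exact: Lfun_cst.
  apply: aeW => x; rewrite rayE; under eq_fun do rewrite rayE.
  apply: cvg_near_cst; have [xu|ux] := leP x u.
    apply: nearW => n; have /andP[h _] := hr n.
    by rewrite (le_trans xu (ltW h)).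
  have xu0 : 0 < x - u by rewrite subr_gt0.
  have /cvgr0Pnorm_lt/(_ _ xu0)[N _ hN] := @cvg_harmonic R.
  exists N => // n Nn; have := hN n Nn; rewrite /= ger0_norm ?invr_ge0 // => h.
  have /andP[_ h'] := hr n; rewrite leNgt (lt_trans h') //.
  by rewrite -ltrBrDl.
apply: aeW => x n; rewrite rayE normr_nat /=.
by case: (x <= _)%R; [exact: lexx|exact: ler01].
Qed.

(** Normalised indicators of the disjoint intervals between consecutive reciprocals of integers. *)
Lemma L2_unit_dim_infinite n : exists h : nat -> L2 mu01, orthonormal_upto (@ip2 _ _ _ mu01) n h.
Proof.
pose A (i : nat) : set (borelR R) := `]i.+2%:R^-1, i.+1%:R^-1[%classic.
have mA i : measurable (A i) by exact: measurable_itv.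
have A01 i : A i `<=` `]0, 1[%classic.
  move=> x; rewrite /A /= !in_itv /= => /andP[h1 h2]; apply/andP; split.
    by apply: lt_trans h1; rewrite invr_gt0.
  by apply: lt_le_trans h2 _; rewrite invf_le1 // ler1n.
pose m (i : nat) : R := i.+1%:R^-1 - i.+2%:R^-1.
have m0 i : 0 < m i by rewrite subr_gt0 ltf_pV2 ?posrE // ltr_nat.
have muA i : mu01 (A i) = (m i)%:E.
  rewrite /mu01 /= /mrestr setIidl // lebesgue_measure_itv /= lte_fin.
  by rewrite -subr_gt0 m0 -EFinB.
pose h i : L2 mu01 := (Num.sqrt (m i))^-1 *: toL2 mu01 \1_(A i).
have hip := semi_inner_ip2 mu01.
exists h => i j _ _; rewrite /h (ipZl hip) (ipZr hip).
have [<-|ij] := eqVneq i j.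
  have -> : ip2 (toL2 mu01 \1_(A i)) (toL2 mu01 \1_(A i)) = m i.
    apply: EFin_inj; rewrite ip2_sqr -(muA i) -[X in mu01 X]setIT -integral_indic //.
    apply: eq_integral => x _; rewrite toL2E ?indic_L2 // indicE.
    by case: (x \in A i); rewrite ?expr1n ?expr0n.
  by rewrite mulrA -invfM -expr2 sqr_sqrtr ?mulVf // ?gt_eqF // ltW.
rewrite [ip2 _ _](_ : _ = 0) ?mulr0 //.
rewrite /ip2 (_ : (fun x => _) = cst 0); first by rewrite Rintegral_cst // mul0r.
apply/funext => x; rewrite !toL2E ?indic_L2 // !indicE.
case: (boolP (x \in A i)) => [|_]; last by rewrite mul0r.
case: (boolP (x \in A j)) => [|_]; last by rewrite mulr0.
rewrite !inE /A /= !in_itv /= => /andP[j1 j2] /andP[i1 i2]; exfalso.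
have key (a b : nat) : (a < b)%N -> x < b.+1%:R^-1 -> a.+2%:R^-1 < x -> False.
  move=> ab xb xa; have := lt_trans xa xb.
  by rewrite ltf_pV2 ?posrE // ltr_nat ltnS ltnNge ab.
case: (ltngtP i j) ij => // ij _; [exact: (key i j)|exact: (key j i)].
Qed.

End UnitInterval.

(** * The kernel of a copula *)

Section CopulaKernel.
Variables (R : realType) (C : R -> R -> R) (c : R * R -> R).
Hypothesis hC : copula C.
Hypothesis hsym : symmetric_copula C.
Hypothesis hc : copula_density C c.
Hypothesis hc2 : (square_norm2 c < +oo)%E.
Local Notation mu := (mu01 R).
Local Notation I := (`]0%R, 1%R[%classic : set (borelR R)).

(** Two changes of integrand: [g] is built from [c], [g0] from its extension by zero, and [g1]
    differs from [g0] only on a null set of rows. Tonelli's theorem makes the inner integrals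
    measurable. *)
Lemma iterated_integral01 (g g0 g1 : R * R -> \bar R) :
  measurable_fun (setT : set (borelR R * borelR R)) g0 ->
  measurable_fun (setT : set (borelR R * borelR R)) g1 ->
  (forall z, 0 <= g0 z)%E -> (forall z, 0 <= g1 z)%E ->
  (forall x y, 0 < x < 1 -> 0 < y < 1 -> g (x, y) = g0 (x, y)) ->
  {ae mu, forall x : borelR R, forall y, g0 (x, y) = g1 (x, y)} ->
  (\int[leb R]_(x in `[0%R, 1%R]) \int[leb R]_(y in `[0%R, 1%R]) g (x, y) =
   \int[mu]_x \int[mu]_y g1 (x, y))%E.
Proof.
move=> mg0 mg1 g00 g10 gg0 g01.
have mF0 := @measurable_fun_fubini_tonelli_F _ _ _ _ R mu g0 mg0 g00.
have inner x : 0 < x < 1 ->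
    (\int[leb R]_(y in `[0%R, 1%R]) g (x, y) = \int[mu]_y g0 (x, y))%E.
  move=> x01; have ms : measurable_fun (setT : set (borelR R)) (fun y => g0 (x, y)).
    exact: measurableT_comp mg0 _.
  apply: integral01 => [|//|y y01]; last exact: gg0.
  apply: (@eq_measurable_fun _ _ _ _ I (fun y => g0 (x, y))).
    by move=> y; rewrite inE /= in_itv /= => y01; rewrite gg0.
  exact: measurable_funS ms.
have mF1 := @measurable_fun_fubini_tonelli_F _ _ _ _ R mu g1 mg1 g10.
transitivity (\int[mu]_x fubini_F mu g0 x)%E.
  apply: integral01; [|exact: mF0|exact: inner].
  apply: (@eq_measurable_fun _ _ _ _ I (fubini_F mu g0)).
    by move=> x; rewrite inE /= in_itv /= => x01; rewrite inner.
  exact: measurable_funS mF0.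
have e : {ae mu, forall x : borelR R, setT x -> fubini_F mu g0 x = fubini_F mu g1 x}.
  apply: filterS g01 => x e _; apply: eq_integral => y _; exact: e.
apply: (@ae_eq_integral _ (borelR R) R mu setT (fubini_F mu g1) (fubini_F mu g0)).
- exact: measurableT.
- exact: mF0.
- exact: mF1.
- exact: e.
Qed.

(** [c] is measurable and nonnegative only on the closed unit square; this cut-off is so on the
    whole plane. *)
Let c0 : borelR R * borelR R -> R := c \_ (I `*` I).

Let c0E x y : 0 < x < 1 -> 0 < y < 1 -> c0 (x, y) = c (x, y).
Proof.
move=> x01 y01; rewrite /c0 patchE mem_set //; by split; rewrite /= ?in_itv.
Qed.

Let c0_ge0 z : 0 <= c0 z.
Proof.
rewrite /c0 patchE; case: ifPn => //; rewrite inE => -[/= z1 z2].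
case: z z1 z2 => x y /=; rewrite !in_itv /= => /andP[x0 x1] /andP[y0 y1].
by case: hc => _ + _; apply; rewrite in_itv /= !ltW.
Qed.

Let measurable_c0 : measurable_fun setT c0.
Proof.
case: hc => mc _ _.
apply/(measurable_restrictT _ _).1; first exact: measurableX.
apply: measurable_funS mc; first exact: measurableX.
move=> [x y] []; rewrite /= !in_itv /= => /andP[x0 x1] /andP[y0 y1].
by split; rewrite /= ?in_itv /= !ltW.
Qed.

Let G := fubini_F mu (fun z => (c0 z ^+ 2)%:E).

Let measurable_c02 : measurable_fun setT (fun z => (c0 z ^+ 2)%:E).
Proof. by apply/measurable_EFinP; exact: measurable_funX. Qed.

Let c02_ge0 z : (0 <= (c0 z ^+ 2)%:E)%E.
Proof. by rewrite lee_fin sqr_ge0. Qed.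

Let measurable_G : measurable_fun setT G.
Proof. exact: (@measurable_fun_fubini_tonelli_F _ _ _ _ R mu _ measurable_c02). Qed.

Let G_fin : (\int[mu]_x G x < +oo)%E.
Proof.
move: hc2; rewrite /square_norm2.
rewrite (@iterated_integral01 (fun z => (c z ^+ 2)%:E) _ _ measurable_c02 measurable_c02) //.
  by move=> x y x01 y01; rewrite c0E.
by apply: aeW => x y.
Qed.

Let good : set (borelR R) := [set x | (G x < +oo)%E].

Let measurable_good : measurable good.
Proof. by rewrite -[good]setTI; exact: emeasurable_fun_infty_o. Qed.

Let ae_good : {ae mu, forall x : borelR R, good x}.
Proof.
have iG : mu.-integrable setT G.
  apply/integrableP; split => //.
  under eq_integral do rewrite gee0_abs ?integral_ge0 //.
  exact: G_fin.
apply: filterS (integrable_ae measurableT iG) => x /(_ Logic.I).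
by rewrite /good /= ge0_fin_numE ?integral_ge0.
Qed.

(* Zeroing the rows of c that are not square integrable makes every row an
   element of L^2, so that the operator is linear everywhere, not just a.e. *)
Definition density_kernel (z : borelR R * borelR R) : R := c0 z * \1_good z.1.
Local Notation k := density_kernel.

Let k_c0 x y : good x -> k (x, y) = c0 (x, y).
Proof. by move=> gx; rewrite /k indicE mem_set //= mulr1. Qed.

Lemma measurable_density_kernel :
  measurable_fun (setT : set (borelR R * borelR R)) k.
Proof.
apply: measurable_funM => //.
have m1 : measurable_fun setT (\1_good : borelR R -> R) by exact: measurable_indic.
exact: measurableT_comp m1 measurable_fst.
Qed.

Lemma density_kernel_row (x : borelR R) : (fun y : borelR R => k (x, y)) \in Lfun mu 2%:E.
Proof.
apply/Lfun2P; split; first exact: measurableT_comp measurable_density_kernel _.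
have [gx|ngx] := pselect (good x).
  by under eq_integral do rewrite k_c0 //; exact: gx.
rewrite (eq_integral (cst 0%E)) ?integral_cst ?mul0e ?ltry // => y _.
by rewrite /k indicE memNset //= mulr0 expr0n.
Qed.

Lemma ae_density_kernel : {ae mu, forall x : borelR R, forall y, c0 (x, y) = k (x, y)}.
Proof. by apply: filterS ae_good => x gx y; rewrite k_c0. Qed.

(** A single transfer from [c] to the modified kernel, used with [F] a square, a product with two
    rays, and the squared remainder of the expansion. *)
Lemma iterated_integral_kernel (F : R * R -> R -> R) :
  (forall g : borelR R * borelR R -> R,
    measurable_fun setT g -> measurable_fun setT (fun z => F z (g z))) ->
  (forall z a, 0 <= a -> 0 <= F z a) ->
  (\int[leb R]_(x in `[0%R, 1%R]) \int[leb R]_(y in `[0%R, 1%R]) (F (x, y) (c (x, y)))%:E =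
   \int[mu]_x \int[mu]_y (F (x, y) (k (x, y)))%:E)%E.
Proof.
move=> mF F0.
apply: (@iterated_integral01 (fun z => (F z (c z))%:E) (fun z => (F z (c0 z))%:E)
  (fun z => (F z (k z))%:E)).
- by apply/measurable_EFinP; apply: mF; exact: measurable_c0.
- by apply/measurable_EFinP; apply: mF; exact: measurable_density_kernel.
- by move=> z; rewrite lee_fin F0.
- by move=> z; rewrite lee_fin F0 // mulr_ge0.
- by move=> x y x01 y01; rewrite c0E.
- by apply: filterS ae_density_kernel => x e y; rewrite e.
Qed.

Lemma density_kernel_fin : (\int[mu]_x \int[mu]_y (k (x, y) ^+ 2)%:E < +oo)%E.
Proof.
rewrite -(@iterated_integral_kernel (fun _ a => a ^+ 2)) //.
- by move=> g mg; exact: measurable_funX.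
- by move=> z a _; exact: sqr_ge0.
Qed.

Local Notation K := (@kernel_map _ _ _ mu k).
Local Notation mk := measurable_density_kernel.
Local Notation rowk := density_kernel_row.
Local Notation kfin := density_kernel_fin.

Lemma itv01I u : 0 <= u <= 1 ->
  `[0%R, u]%classic = `[0%R, 1%R]%classic `&` (`]-oo, u]%classic : set (borelR R)).
Proof.
move=> /andP[u0 u1]; apply/seteqP; split=> x /=; rewrite !in_itv /=.
  by move=> /andP[-> xu]; rewrite xu (le_trans xu u1).
by move=> [/andP[-> _] ->].
Qed.

Lemma mem_ray u x : (x \in (`]-oo, u]%classic : set (borelR R))) = (x <= u)%R.
Proof. by apply/idP/idP; rewrite inE /= in_itv. Qed.

Lemma patch_ray (f : R -> R) u x :
  (f \_ (`]-oo, u]%classic : set (borelR R))) x = ray u x * f x.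
Proof.
rewrite rayE patchE mem_ray.
by case: (x <= u)%R; [rewrite mul1r|rewrite mul0r].
Qed.

Lemma ip_ray u (f : L2 mu) : 0 <= u <= 1 ->
  ip2 (ray u) f = \int[leb R]_(x in `[0, u]) f x.
Proof.
move=> u01; rewrite (itv01I u01) Rintegral_mkcondr.
have m : measurable_fun (setT : set (borelR R)) (fun x => ray u x * f x).
  exact: measurable_funM.
apply/esym; apply: Rintegral01 => [|//|x _]; last exact: patch_ray.
apply: (@eq_measurable_fun _ _ _ _ I (fun x => ray u x * f x)).
  by move=> x _; rewrite patch_ray.
exact: measurable_funS m.
Qed.

Lemma copula_ray u v : 0 <= u <= 1 -> 0 <= v <= 1 ->
  C u v = ip2 (ray u) (K (ray v)).
Proof.
move=> u01 v01; apply: EFin_inj; have [_ _ ->] := hc; rewrite ?in_itv //.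
pose F (z : R * R) a : R := ray u z.1 * (ray v z.2 * a).
have mF (g : borelR R * borelR R -> R) : measurable_fun setT g ->
    measurable_fun setT (fun z => F z (g z)).
  move=> mg; apply: measurable_funM.
    exact: measurableT_comp (L2_measurable (ray u)) measurable_fst.
  apply: measurable_funM; last exact: mg.
  exact: measurableT_comp (L2_measurable (ray v)) measurable_snd.
transitivity (\int[leb R]_(x in `[0%R, 1%R]) \int[leb R]_(y in `[0%R, 1%R])
    (F (x, y) (c (x, y)))%:E)%E.
  rewrite (itv01I u01) integral_mkcondr; apply: eq_integral => x _.
  rewrite patchE /F /= rayE mem_ray; case: (x <= u)%R.
    rewrite (itv01I v01) integral_mkcondr; apply: eq_integral => y _.
    by rewrite patchE rayE mem_ray mul1r; case: (y <= v)%R; [rewrite mul1r|rewrite mul0r].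
  rewrite (eq_integral (cst 0%E)) ?integral_cst ?mul0e // => y _.
  by rewrite mul0r.
rewrite iterated_integral_kernel; first last.
- by move=> z a a0; rewrite /F !rayE !mulr_ge0.
- exact: mF.
rewrite ip2_EFin; apply: eq_integral => x _.
rewrite /F (kernel_mapE mk rowk kfin) /kernel_fun EFinM ip2_EFin.
rewrite -integralZl //; last exact: integrable_mul.
apply: eq_integral => y _; rewrite -EFinM (kernel_rowE rowk) /=.
by rewrite (mulrC (k _)).
Qed.

(** By [copula_ray], the symmetry of [C] is the symmetry of the operator between rays, which
    suffices by density. *)
Lemma density_kernel_sym f g : ip2 (K f) g = ip2 f (K g).
Proof.
apply: (kernel_map_sym_on mk rowk kfin (D := [set ray u | u in [set u | 0 <= u <= 1]])).
  by move=> P cP PD; apply: rays_dense => // u u01; apply: PD; exists u.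
move=> _ _ [u u01 <-] [v v01 <-]; rewrite (ipC (semi_inner_ip2 mu)).
by rewrite -!copula_ray // hsym // in_itv.
Qed.

Lemma uniform_mu01 (A : set (borelR R)) : measurable A ->
  uniform_prob (@ltr01 R) A = mu A.
Proof.
move=> mA; have m1 : measurable_fun setT (EFin \o \1_A : borelR R -> \bar R).
  by apply/measurable_EFinP; exact: measurable_indic.
rewrite -[A in LHS]setIT -[A in RHS]setIT -!integral_indic // integral_uniform //.
  rewrite subr0 invr1 mul1e; apply: integral01 => //; exact: measurable_funS m1.
Qed.

(** [C u 1] is the mass of a quadrant, the marginal that of a full half plane; the part above height
    1 is null by the other marginal. *)
Lemma copula_marginal u : 0 <= u <= 1 -> (C u 1)%:E = mu `]-oo, u]%classic.
Proof.
move=> u01; have [P [P1 P2 PC]] := hC.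
have i11 : (1 : R) \in `[0, 1] by rewrite in_itv /= ler01 lexx.
pose A : set (borelR R) := `]-oo, u]%classic.
pose B : set (borelR R) := `]-oo, 1]%classic.
pose B' : set (borelR R) := `]1, +oo[%classic.
have mA : measurable A by exact: measurable_itv.
have mB : measurable B by exact: measurable_itv.
have mB' : measurable B' by exact: measurable_itv.
have key : P (A `*` setT) = P (A `*` B).
  have -> : A `*` setT = (A `*` B) `|` (A `*` B').
    apply/seteqP; split=> [[x y] [/= xu _]|[x y] [[/= xu _]|[/= xu _]]] //=.
    have [y1|y1] := leP y 1; [left|right]; (split; first exact: xu).
      by rewrite /B /= in_itv.
    by rewrite /B' /= in_itv /= y1.
  rewrite measureU; [|exact: measurableX|exact: measurableX|].
    rewrite [X in (_ + X)%E](_ : _ = 0%E) ?adde0 //.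
    apply/eqP; rewrite eq_le measure_ge0 andbT.
    apply: (@le_trans _ _ (P (setT `*` B'))).
      apply: le_measure; rewrite ?inE; try exact: measurableX.
      by move=> [x y] [].
    rewrite P2 // uniform_mu01 // /mu01 /= /mrestr.
    rewrite (_ : _ `&` _ = set0) ?measure0 //.
    apply/seteqP; split=> // y /=; rewrite /B' /= !in_itv /= andbT => -[y1 /andP[_]].
    by rewrite ltNge (ltW y1).
  apply/seteqP; split=> // -[x y] [[_ /= yB] [_ /= yB']].
  by move: yB yB'; rewrite /B /B' /= !in_itv /= andbT => y1; rewrite ltNge y1.
by rewrite (PC u 1) ?in_itv // -[LHS]/(P (A `*` B)) -key P1 // uniform_mu01.
Qed.

Local Notation e0 := (toL2 mu (cst 1)).

Let e0E x : e0 x = 1.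
Proof. by rewrite toL2E ?Lfun_cst. Qed.

Lemma ip_ray_one u : 0 <= u <= 1 -> ip2 (ray u) e0 = u.
Proof.
move=> u01; rewrite ip_ray //; under eq_Rintegral do rewrite e0E.
have e : (leb R `[0%R, u]%classic = u%:E)%E.
  rewrite lebesgue_measure_itv /= lte_fin; have /andP[u0 _] := u01.
  case: ltP => [_|u0']; first by rewrite -EFinB subr0.
  by congr (_%:E); apply/eqP; rewrite eq_le u0 u0'.
rewrite Rintegral_cst; last exact: measurable_itv.
by rewrite mul1r; exact: (congr1 fine e).
Qed.

Let hip := semi_inner_ip2 mu.

Let ip_ray1 f : ip2 (ray 1) f = ip2 e0 f.
Proof.
rewrite ip_ray ?ler01 ?lexx // -inner01E /inner01.
by apply: eq_Rintegral => x _; rewrite e0E mul1r.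
Qed.

Lemma ip_one : ip2 e0 e0 = 1.
Proof. by rewrite -ip_ray1 ip_ray_one // ler01 lexx. Qed.

(** Uniform marginals in operator form: [K e0] and [e0] have the same product with [ray u], namely
    [C u 1 = u]. Symmetry moves [K] away from [e0], where [ip_ray1] can replace [e0] by [ray 1]. *)
Lemma density_kernel_one : eigenvector (@ip2 _ _ R mu) K 1 e0.
Proof.
have h (f : L2 mu) : ip2 f (K e0) = ip2 f e0.
  apply: (@rays_dense R (fun f => ip2 f (K e0) = ip2 f e0)).
    split=> [a g1 g2 h1 h2|v g hv vg].
      by rewrite !(ipDl hip) !(ipZl hip) h1 h2.
    rewrite -(cvg_lim (@Rhausdorff R) (qcvg_ip (y := K e0) hip vg)).
    rewrite -(cvg_lim (@Rhausdorff R) (qcvg_ip (y := e0) hip vg)).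
    by have -> : (fun n => ip2 (v n) (K e0)) = (fun n => ip2 (v n) e0) by apply/funext.
  move=> u u01; have u11 : 0 <= (1 : R) <= (1 : R) by rewrite ler01 lexx.
  rewrite -density_kernel_sym (ipC hip) -ip_ray1 (ipC hip) density_kernel_sym -copula_ray //.
  apply: EFin_inj; rewrite copula_marginal // -[X in mu X]setIT -integral_indic //.
  rewrite ip2_EFin; apply: eq_integral => x _.
  by rewrite e0E mulr1 rayE indicE mem_ray.
by rewrite /eigenvector scale1r (ipBr hip) h subrr.
Qed.

Lemma eigenfunction_density_kernel a (f : L2 mu) : ip2 f f = 1 ->
  eigenvector (@ip2 _ _ R mu) K a f -> eigenfunction c a f.
Proof.
move=> f1 fa; split; first exact: (LfunP f).
  move=> f0; have {}f0 : {ae mu, forall x : borelR R, setT x -> f x = 0} := f0.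
  have : ip2 f f = 0.
    apply: EFin_inj; rewrite ip2_sqr.
    rewrite (@ae_eq_integral _ (borelR R) R mu setT (cst 0%E)) //; last 2 first.
    - by apply/measurable_EFinP; exact: measurable_funX.
    - by apply: filterS f0 => x /(_ Logic.I) -> _; rewrite expr0n.
    by rewrite integral_cst // mul0e.
  by rewrite f1 => /eqP; rewrite oner_eq0.
have x01 : {ae mu, forall x : borelR R, 0 < (x : R) < 1} by exact: ae01.
suff : {ae mu, forall x : borelR R, setT x -> kernel_op c f x = a * f x} by [].
(* Three conditions on [x]: it is interior, its row of [c] is that of the modified kernel, and the
   eigenvalue equation holds at it. *)
apply: filterS3 x01 ae_density_kernel (ip2_null fa) => x x0 kx /(_ Logic.I) fx _.
have -> : kernel_op c f x = K f x.
  rewrite (kernel_mapE mk rowk kfin) /kernel_fun /kernel_op.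
  rewrite /ip2; under [RHS]eq_Rintegral do rewrite (kernel_rowE rowk).
  have m : measurable_fun (setT : set (borelR R)) (fun y => k (x, y) * f y).
    apply: measurable_funM => //; exact: measurableT_comp mk _.
  have ck y : 0 < y < 1 -> c (x, y) * f y = k (x, y) * f y.
    by move=> y0; rewrite -kx c0E.
  apply: Rintegral01 => //.
  apply: (@eq_measurable_fun _ _ _ _ I (fun y => k (x, y) * f y)).
    by move=> y; rewrite inE /= in_itv /= => y0; rewrite ck.
  exact: measurable_funS m.
by apply/eqP; rewrite -subr_eq0; apply/eqP; exact: fx.
Qed.

End CopulaKernel.

(** * Indices starting at 2 and the representation of the copula *)

Lemma cvg_shift2 (T : topologicalType) (a b : nat -> T) (l : T) :
  (forall n, a n.+2 = b n.+1) -> b n @[n --> \oo] --> l -> a n @[n --> \oo] --> l.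
Proof.
move=> ab bl U /bl[N _ hN]; exists N.+2 => // -[|[|n]] //= Nn.
by rewrite /= ab; apply: hN; apply: leqW; rewrite -2!ltnS.
Qed.

Lemma big_nat2_shift (R : realType) (F : nat -> R) n :
  \sum_(2 <= k < n.+2) F k = \sum_(j < n) F j.+2.
Proof. by rewrite !big_add1 big_mkord. Qed.

Unset Implicit Arguments.

Theorem theorem2p2 (R : realType) (C : R -> R -> R) (c : R * R -> R)
    (hC : copula C) (hsym : symmetric_copula C) (hc : copula_density C c)
    (hc2 : (square_norm2 c < +oo)%E) :
  exists (phi : nat -> R -> R) (lambda : nat -> R),
    [/\ orthonormal_basis (with_one phi),
        eigenfunction c 1 (cst 1),
        forall k : nat, (1 < k)%N -> eigenfunction c (lambda k) (phi k),
        square_norm2 (fun p => c p -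
            (1 + \sum_(2 <= k < n) lambda k * phi k p.1 * phi k p.2))
          @[n --> \oo] --> 0%E &
        forall u v : R, u \in `[0, 1] -> v \in `[0, 1] ->
          u * v + \sum_(2 <= k < n) lambda k
                    * (\int[leb R]_(x in `[0, u]) phi k x)
                    * (\int[leb R]_(y in `[0, v]) phi k y)
          @[n --> \oo] --> C u v].
Proof.
have hip := semi_inner_ip2 (mu01 R).
have mk := measurable_density_kernel hc.
have rowk := density_kernel_row hc.
have kfin := density_kernel_fin hc hc2.
have ksym := density_kernel_sym hsym hc hc2.
have one1 := density_kernel_one hC hsym hc hc2.
have [e [lam [e0 oe ee ecvg kcvg]]] := kernel_spectral mk rowk kfin
  (@rational_rays_dense R) ksym (@L2_unit_dim_infinite R) (ip_one R) one1.
have e01 x : e 0%N x = 1 by rewrite e0 toL2E // Lfun_cst.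
(* [lam] was obtained by choice, so its first value has to be read off from [ip2 (K e0) e0]. *)
have lam0 : lam 0%N = 1.
  have := eigenvector_ip hip (e 0%N) (ee 0%N).
  rewrite oe mulr1 e0 => <-.
  by rewrite (eigenvector_ip hip _ one1) -e0 oe mulr1.
(* The shift puts [e 1] at index 2; the values at 0 and 1 are arbitrary. *)
pose phi n : R -> R := e n.-1; pose lambda n := lam n.-1.
have phiE : with_one phi = (fun n => e n : R -> R).
  by apply/funext => -[|n] //=; apply/funext => x; rewrite e01.
exists phi, lambda; split.
- rewrite phiE; split.
  + by move=> n; exact: (LfunP (e n)).
  + by move=> m n; rewrite inner01E.
  + move=> f Lf; have fE : toL2 (mu01 R) f = f :> (R -> R) by rewrite toL2E.
    (* The sign is that of [qcvg], partial sum minus limit; squaring makes it harmless. *)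
    pose g n := \sum_(j < n) ip2 (toL2 (mu01 R) f) (e j) *: e j - toL2 (mu01 R) f.
    have norm_g n : ('N[leb01 R]_2%:E[EFin \o (fun x =>
          f x - \sum_(0 <= k < n) inner01 f (e k) * e k x)%R])%E =
        (Num.sqrt (ip2 (g n) (g n)))%:E.
      rewrite (@Lnorm2E _ _ R (mu01 R)).
      have -> : (\int[mu01 R]_x
          ((f x - \sum_(0 <= j < n) inner01 f (e j) * e j x) ^+ 2)%:E)%E =
          (ip2 (g n) (g n))%:E.
        rewrite ip2_sqr; apply: eq_integral => x _; congr (_%:E).
        rewrite -sqrrN opprB; congr (_ ^+ 2).
        rewrite -[RHS]/((\sum_(j < n) ip2 (toL2 (mu01 R) f) (e j) *: e j) x -
          toL2 (mu01 R) f x).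
        rewrite L2_sumE fE big_mkord; congr (_ - _); apply: eq_bigr => j _.
        by rewrite -inner01E fE.
      by rewrite poweR_EFin powR12_sqrt // (ip_ge0 hip).
    under eq_fun do rewrite norm_g.
    apply: cvg_EFin; first exact: nearW.
    rewrite -(@sqrtr0 R); apply: continuous_cvg; first exact: sqrt_continuous.
    exact: ecvg.
- have := eigenfunction_density_kernel hc hc2 (ip_one R) one1.
  by rewrite toL2E // Lfun_cst.
- move=> n _; apply: (eigenfunction_density_kernel hc hc2); last exact: ee.
  by rewrite oe eqxx.
(* The sum over [2 <= k < n.+2] has [n] terms and the constant 1 adds one, giving the partial sum of
   order [n.+1]: hence the unequal shifts in [cvg_shift2]. *)
- apply: cvg_shift2 kcvg => n.
  pose F (z : R * R) a : R :=
    (a - \sum_(j < n.+1) lam j * e j z.1 * e j z.2) ^+ 2.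
  have mF (g : borelR R * borelR R -> R) : measurable_fun setT g ->
      measurable_fun setT (fun z => F z (g z)).
    move=> mg; apply: measurable_funX; apply: measurable_funB; first exact: mg.
    apply: measurable_sum => j; apply: measurable_funM.
      apply: measurable_funM; first exact: measurable_cst.
      exact: measurableT_comp (L2_measurable (e j)) measurable_fst.
    exact: measurableT_comp (L2_measurable (e j)) measurable_snd.
  rewrite -(@iterated_integral_kernel _ _ _ hc hc2 F).
  + rewrite /square_norm2; apply: eq_integral => x _; apply: eq_integral => y _.
    congr (_%:E); rewrite /F /= big_nat2_shift big_ord_recl lam0 !e01 !mulr1.
    by [].
  + exact: mF.
  + by move=> z a _; exact: sqr_ge0.
- move=> u v; rewrite !in_itv /= => u01 v01.
  rewrite (copula_ray hc hc2 u01 v01).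
  (* The Fourier expansion of [ray u] is paired with [K (ray v)]: continuity of the pairing gives
     convergence at every [(u, v)], and symmetry turns each term into [lam j] times two
     coefficients. *)
  have h := qcvg_ip (y := kernel_map (density_kernel c) (ray v)) hip (ecvg (ray u)).
  apply: cvg_shift2 h => n.
  rewrite (ip_suml hip) big_nat2_shift big_ord_recl; congr (_ + _).
    rewrite (ipZl hip) -ksym (eigenvector_ip hip _ (ee _)) lam0 mul1r e0.
    by rewrite (ipC hip _ (ray v)) !ip_ray_one.
  apply: eq_bigr => j _; rewrite (ipZl hip) -ksym (eigenvector_ip hip _ (ee _)).
  by rewrite (ipC hip _ (ray v)) !ip_ray // mulrA (mulrC (lambda _)).
Qed.
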